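(* Let $\mathcal{Q}$ be a class of probability distributions over a space $\mathcal{X}$, and suppose $\mathrm{Red}(\mathcal{Q}^{\otimes t})\le R(t)$ for all $t$, for some concave function $R(\cdot)$. Then for $n\gtrsim k^2$, $$\mathrm{Risk}(\mathcal{P}^{\mathsf{HMM}}_n(k,\mathcal{Q}))\lesssim\frac{k^2}{n}\log\frac{n}{k^2}+\frac{k}{n}R\left(\frac{n+1}{k}\right).$$
   Context: $\lesssim,\gtrsim$ denote inequalities up to universal multiplicative constants: there are universal constants $c,C$ such that the bound holds with constant $C$ whenever $n\ge ck^2$. The function $R:[0,\infty)\to[0,\infty)$ is a function of a real argument. $\mathcal{P}^{\mathsf{HMM}}_n(k,\mathcal{Q})$ is the collection of joint laws of $X^{n+1}=(X_1,\dots,X_{n+1})$ of stationary HMMs with hidden states in $[k]=\{1,\dots,k\}$ and emissions in $\mathcal{Q}$: $\{Z_t\}$ is a stationary Markov chain on $[k]$ (arbitrary transition matrix) and, given $Z^{n+1}$, the $X_t\in\mathcal{X}$ are independent with $X_t\sim P_{X|Z}(\cdot|Z_t)$, where $P_{X|Z}(\cdot|z)\in\mathcal{Q}$ for every $z\in[k]$. For a class $\mathcal{P}$ of distributions, $\mathrm{Red}(\mathcal{P})=\inf_{Q}\sup_{P\in\mathcal{P}}\mathrm{KL}(P\|Q)$, the infimum being over all probability distributions $Q$ on the same space; $\mathcal{Q}^{\otimes t}=\{Q^{\otimes t}:Q\in\mathcal{Q}\}$ is the i.i.d. class with $t$ observations. For a class $\mathcal{P}_{n+1}$ of laws of $X^{n+1}$,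 $$\mathrm{Risk}(\mathcal{P}_{n+1})=\inf_{Q_{X_{n+1}|X^n}}\sup_{P\in\mathcal{P}_{n+1}}\mathbb{E}_P[\mathrm{KL}(P_{X_{n+1}|X^n}\|Q_{X_{n+1}|X^n})].$$ *)

(* Defs.v *)
From HB Require Import structures.
From mathcomp Require Import all_boot all_order all_algebra.
From mathcomp Require Import all_classical all_reals all_analysis.
From mathcomp Require Import measurable_realfun.

Set Implicit Arguments.
Unset Strict Implicit.
Unset Printing Implicit Defensive.

Import Order.TTheory GRing.Theory Num.Theory.
Import numFieldNormedType.Exports.

Local Open Scope classical_set_scope.
Local Open Scope charge_scope.
Local Open Scope ring_scope.

(* The derivative is positive P-almost everywhere, so the junk value of [ln] on
   nonpositive reals is irrelevant.  The negative part of the integrand is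
   P-integrable, so the integral is never of the form +oo - oo. *)
Definition KL d (T : measurableType d) (R : realType)
    (P Q : probability T R) : \bar R :=
  if `[< P `<< Q >] then
    (\int[P]_x (ln (fine (('d (charge_of_finite_measure P) '/d Q) x)))%:E)%E
  else +oo%E.

Definition Red d (T : measurableType d) (R : realType)
    (C : set (probability T R)) : \bar R :=
  ereal_inf [set ereal_sup [set KL P Q | P in C] | Q in [set: probability T R]].

(* Boxes of measurable sets form a pi-system generating the product
   sigma-algebra of [n.-tuple T], so they determine [mu]. *)
Definition is_iid_law d (T : measurableType d) (R : realType) (t : nat)
    (P : probability T R) (mu : probability (t.-tuple T) R) : Prop :=
  forall B : 'I_t -> set T, (forall i, measurable (B i)) ->
    mu [set w | forall i, B i (tnth w i)] = (\prod_(i < t) P (B i))%E.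

Definition iid_class d (T : measurableType d) (R : realType)
    (Qs : set (probability T R)) (t : nat) : set (probability (t.-tuple T) R) :=
  [set mu : probability (t.-tuple T) R | exists2 P, Qs P & is_iid_law P mu].
Arguments iid_class {d T R} Qs t.

(* Times start at 0.  The hidden chain Z has initial law [init], moves from i to
   j with probability [trans i j], and emits with law [emis i] in state i.
   [hmm_emission] is the conditional independence of the observations given the
   hidden path, multiplied out so that paths of probability 0 need no care. *)
Record is_stationary_hmm d (T : measurableType d) (R : realType) (k : nat)
    d' (Omega : measurableType d') (Pr : probability Omega R)
    (init : 'rV[R]_k) (trans : 'M[R]_k) (emis : 'I_k -> probability T R)
    (Z : nat -> Omega -> 'I_k) (X : nat -> {RV Pr >-> T}) : Prop := {
  hmm_measurable_state : forall t i, measurable [set w | Z t w = i] ;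
  hmm_init_ge0 : forall i, 0 <= init ord0 i ;
  hmm_init_sum : \sum_i init ord0 i = 1 ;
  hmm_trans_ge0 : forall i j, 0 <= trans i j ;
  hmm_trans_sum : forall i, \sum_j trans i j = 1 ;
  hmm_stationary : init *m trans = init ;
  hmm_markov : forall (m : nat) (z : nat -> 'I_k),
    Pr [set w | forall t, (t <= m)%N -> Z t w = z t] =
    (init ord0 (z 0%N) * \prod_(t < m) trans (z t) (z t.+1))%:E ;
  hmm_emission : forall (m : nat) (z : nat -> 'I_k) (B : nat -> set T),
    (forall t, measurable (B t)) ->
    Pr [set w | forall t, (t <= m)%N -> Z t w = z t /\ B t (X t w)] =
    (Pr [set w | forall t, (t <= m)%N -> Z t w = z t] *
     \prod_(t < m.+1) emis (z t) (B t))%E }.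

(* Laws of [X^{n+1}], the first [n.+1] observations. *)
Definition hmm_class d (T : measurableType d) (R : realType) (n k : nat)
    (Qs : set (probability T R)) : set (probability (n.+1.-tuple T) R) :=
  [set P : probability (n.+1.-tuple T) R | exists d' (Omega : measurableType d') (Pr : probability Omega R)
      (init : 'rV[R]_k) (trans : 'M[R]_k) (emis : 'I_k -> probability T R)
      (Z : nat -> Omega -> 'I_k) (X : nat -> {RV Pr >-> T}),
    [/\ is_stationary_hmm init trans emis Z X,
        forall z, Qs (emis z) &
        forall A, measurable A ->
          P A = Pr [set w | A [tuple X t w | t < n.+1]]]].
Arguments hmm_class {d T R} n k Qs.

Definition past {T : Type} {n : nat} (w : n.+1.-tuple T)
  : n.-tuple T := [tuple tnth w (widen_ord (leqnSn n) i) | i < n].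

Definition future {T : Type} {n : nat} (w : n.+1.-tuple T) : T :=
  tnth w ord_max.

Notation predictor T R n := {mfun n.-tuple T >-> pprobability T R}.

(* [K] is a version of the regular conditional law P_{X_{n+1}|X^n}. *)
Definition is_cond_law d (T : measurableType d) (R : realType) (n : nat)
    (P : probability (n.+1.-tuple T) R) (K : predictor T R n) : Prop :=
  forall (A : set (n.-tuple T)) (B : set T), measurable A -> measurable B ->
    P (past @^-1` A `&` future @^-1` B) =
    (\int[P]_(w in past @^-1` A) (K (past w) : probability T R) B)%E.

(* E_P[KL(P_{X_{n+1}|X^n} || Q)].  When the sigma-algebra of T is countably
   generated (e.g. T standard Borel) any two versions of the conditional law
   agree P-almost surely and the integrand is always measurable, so that the
   infimum is over a single value.  On an arbitrary measurable space versions
   may differ on a non-null set; the infimum makes the quantity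
   well defined there too (+oo when there is no version). *)
Definition cond_KL d (T : measurableType d) (R : realType) (n : nat)
    (P : probability (n.+1.-tuple T) R) (Q : predictor T R n) : \bar R :=
  ereal_inf [set (\int[P]_w KL (K (past w)) (Q (past w)))%E | K in
    [set K : predictor T R n | is_cond_law P K /\
      measurable_fun [set: n.-tuple T]
        (fun x => KL (K x) (Q x) : \bar R)]].

Definition Risk d (T : measurableType d) (R : realType) (n : nat)
    (C : set (probability (n.+1.-tuple T) R)) : \bar R :=
  ereal_inf [set ereal_sup [set cond_KL P Q | P in C]
            | Q in [set: predictor T R n]].

Definition concave_on_nonneg (R : realType) (f : R -> R) : Prop :=
  convex_function (`[0, +oo[%classic : set R) (fun x => - f x).

(* Main.v *)
Require Import Defs.
From HB Require Import structures.
From mathcomp Require Import all_boot all_order all_algebra.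
From mathcomp Require Import all_classical all_reals all_analysis.
From mathcomp Require Import measurable_realfun.
From mathcomp Require Import ring lra.

Set Implicit Arguments.
Unset Strict Implicit.
Unset Printing Implicit Defensive.

Import Order.TTheory GRing.Theory Num.Theory.
Import numFieldNormedType.Exports.
Local Open Scope classical_set_scope.
Local Open Scope ring_scope.

(** The forecaster is built from a code for the observations, that is, from a
    probability density [q] on sequences of [n.+1] letters with respect to a
    power of a base law [mu] that dominates the whole class.

    To forecast from a past of length [n], average over [t <= n] the conditional
    densities of [q] after the last [t] letters alone ([avg_density]).  Fix a
    window of length [t] and let [a] be the hidden state at its start.  The true
    conditional law of the next letter is a mixture over [a] of its conditional
    laws given [a] and the window, so by convexity of the divergence the loss is
    at most that of predicting an observer who knows [a] ([gkl_window]).  By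
    stationarity [a] has the stationary law and the window is distributed as the
    first [t] letters of the chain started at [a]; hence the losses for
    [t = 0, ..., n] add up, by the chain rule ([sum_pred_risk]), to the
    divergence between the law of [n.+1] observations of the chain started at
    [a] and [q].  The risk is therefore at most [n.+1%:R^-1] times the redundancy
    of [q] for hidden Markov models with arbitrary initial state
    ([tint_avg_density]).  Since [q] is good for every initial state, no separate
    term accounts for the memory of the process.

    The code [q] is a mixture over hidden paths ([path_mixture]).  Given the
    path, the letters emitted in each state are i.i.d., and they are coded by a
    near-optimal code for i.i.d. blocks of that length ([ex_block_density]).
    Divergences add up over the blocks ([tint_gkl_path]), and by concavity of
    the bound [rho] the total is at most [k%:R * rho (n.+1%:R / k%:R)] up to
    [O(k)] ([jensen_path_cost]).  The path itself is coded by its type, the first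
    state and the transition counts: a Markov law is constant on types, so the
    weight that is uniform over types and within each type costs at most the
    logarithm of the number of types ([tint_gkl_mixture]), which is
    [O(k ^ 2 * ln (n / k ^ 2))] ([ln_card_markov_types]).

    The space of letters is arbitrary, so regular conditional laws of a
    near-optimal code need not exist.  Discarding its part singular to the
    powers of [mu] does not hurt, as no law of the class charges it, and leaves a
    density ([ex_regular_density]); conditional laws are then ratios of
    marginal densities. *)

(** * Divergence of densities, pointwise *)

Section gkl.
Context {R : realType}.
Implicit Types a b c t : R.

(** The integrand of the Kullback-Leibler divergence between two densities,
    plus [b - a].  The correction integrates to zero between probability
    densities and makes the integrand nonnegative, so that exchanges of
    integrals need no integrability condition.  For [b = 0 < a], where the value
    should be [+oo], the formula is meaningless; this case is excluded below by
    hypotheses [b = 0 -> a = 0]. *)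
Definition gkl a b : R := a * ln (a / b) - a + b.

Lemma gkl0l b : gkl 0 b = b.
Proof. by rewrite /gkl mul0r subr0 add0r. Qed.

(** [gkl] is the supremum over [t] of these functions affine in [(a, b)], because
    [ln u <= u - 1]. *)
Lemma gkl_ge_affine t a b : 0 < t -> 0 <= a -> 0 <= b -> (b = 0 -> a = 0) ->
  a * ln t + b * (1 - t) <= gkl a b.
Proof.
move=> t0; rewrite le_eqVlt => /orP[/eqP<- b0 _|a0 b0 ba].
  by rewrite gkl0l mul0r add0r mulrBr mulr1 gerBl mulr_ge0 // ltW.
have {}b0 : 0 < b.
  by rewrite lt_neqAle b0 andbT eq_sym; apply: contraTneq a0 => /ba ->; rewrite ltxx.
have tba : 0 < t * b / a by rewrite divr_gt0 // mulr_gt0.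
have : ln (t * b / a) <= t * b / a - 1.
  rewrite -[X in ln X](_ : 1 + (t * b / a - 1) = _); last by rewrite addrC subrK.
  by rewrite le_ln1Dx // ltrBDl subrr.
rewrite -(ler_pM2l a0) /gkl.
rewrite -mulrA lnM ?posrE ?divr_gt0 // -(invf_div a b) lnV ?posrE ?divr_gt0 //.
have -> : a * (t * (a / b)^-1 - 1) = t * b - a.
  by field; rewrite !gt_eqF.
lra.
Qed.

Lemma gkl_ge0 a b : 0 <= a -> 0 <= b -> (b = 0 -> a = 0) -> 0 <= gkl a b.
Proof.
by move=> a0 b0 ba; have := gkl_ge_affine ltr01 a0 b0 ba; rewrite ln1; lra.
Qed.

Lemma gklM c a b : 0 <= c -> gkl (c * a) (c * b) = c * gkl a b.
Proof.
rewrite le_eqVlt => /orP[/eqP<-|c0]; first by rewrite !mul0r gkl0l.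
by rewrite /gkl -mulf_div divff ?gt_eqF // mul1r; ring.
Qed.

(** The log-sum inequality.  Each summand lies above its minorant of
    [gkl_ge_affine] at [t := (\sum a) / (\sum b)], and at this [t] the minorants
    add up to the left-hand side. *)
Lemma gkl_sum (I : Type) (s : seq I) (a b : I -> R) :
  (forall i, 0 <= a i) -> (forall i, 0 <= b i) -> (forall i, b i = 0 -> a i = 0) ->
  gkl (\sum_(i <- s) a i) (\sum_(i <- s) b i) <= \sum_(i <- s) gkl (a i) (b i).
Proof.
move=> a0 b0 ab; set A := \sum_(i <- s) a i; set B := \sum_(i <- s) b i.
have : 0 <= A by apply: sumr_ge0.
rewrite le_eqVlt => /orP[/eqP A0|A0].
  rewrite -A0 gkl0l /B; elim: s @A @B A0 => [|i s ih] A B; first by rewrite !big_nil.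
  rewrite /A !big_cons => /esym/eqP; rewrite paddr_eq0 ?sumr_ge0 // => /andP[/eqP ai0 /eqP s0].
  by rewrite ai0 gkl0l lerD2l ih.
have B0 : 0 < B.
  rewrite lt_neqAle sumr_ge0 // andbT; apply/negP => /eqP/esym.
  rewrite /B /A; elim: s @A @B A0 => [|i s ih] A B; first by rewrite /A big_nil ltxx.
  rewrite /A !big_cons => A0 /eqP; rewrite paddr_eq0 ?sumr_ge0 // => /andP[/eqP bi0 /eqP s0].
  by move: A0; rewrite (ab _ bi0) add0r => /ih; apply.
have t0 : 0 < A / B by rewrite divr_gt0.
have -> : gkl A B = \sum_(i <- s) (a i * ln (A / B) + b i * (1 - A / B)).
  rewrite big_split /= -!mulr_suml -/A -/B /gkl mulrBr mulr1 mulrCA divff ?gt_eqF //; lra.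
by apply: ler_sum => i _; apply: gkl_ge_affine => //; exact: ab.
Qed.

(** One step of the chain rule: [p], [b] are the densities of the past and
    [a], [s] (relative to the reference measure of the next letter) the joint
    density under the first law and the conditional density under the second. *)
Lemma gkl_chain p a b s : 0 <= p -> 0 < b -> 0 < s -> 0 <= a -> (p = 0 -> a = 0) ->
  gkl a (b * s) = gkl a (p * s) + (a * ln (p / b) + (b * s - p * s)).
Proof.
move=> p0 b0 s0 a0 pa; move: p0; rewrite le_eqVlt => /orP[/eqP p0|p0].
  by rewrite (pa (esym p0)) !gkl0l -p0; lra.
move: a0; rewrite le_eqVlt => /orP[/eqP <-|a0].
  by rewrite !gkl0l; lra.
rewrite /gkl; have -> : a / (b * s) = (a / (p * s)) * (p / b).
  by field; rewrite !gt_eqF.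
by rewrite lnM ?posrE ?divr_gt0 ?mulr_gt0 //; lra.
Qed.

(** Divergences of the factors of a product add up, each weighted by the other
    [a j].  The correction terms are moved across so that both sides are sums of
    nonnegative products, which can be integrated factor by factor. *)
Lemma gkl_tensor (I : eqType) (s : seq I) (a b : I -> R) :
  uniq s -> (forall i, 0 <= a i) -> (forall i, 0 < b i) ->
  gkl (\prod_(i <- s) a i) (\prod_(i <- s) b i)
  + ((\sum_(i <- s) \prod_(j <- s) (if j == i then b j else a j)) + \prod_(i <- s) a i) =
  (\sum_(i <- s) \prod_(j <- s) (if j == i then gkl (a j) (b j) else a j))
  + ((size s)%:R * \prod_(i <- s) a i + \prod_(i <- s) b i).
Proof.
move=> us a0 b0.
have key (c : I -> R) : \sum_(i <- s) \prod_(j <- s) (if j == i then c j else a j) =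
    \sum_(i <- s) c i * \prod_(j <- s | j != i) a j.
  rewrite [LHS]big_seq [RHS]big_seq; apply: eq_bigr => i si.
  rewrite (bigD1_seq i) //= eqxx; congr (_ * _).
  by apply: eq_bigr => j /negbTE ->.
rewrite !key.
have split_gkl : \sum_(i <- s) gkl (a i) (b i) * \prod_(j <- s | j != i) a j =
    \prod_(i <- s) a i * ln (\prod_(i <- s) a i / \prod_(i <- s) b i)
    - (size s)%:R * \prod_(i <- s) a i
    + \sum_(i <- s) b i * \prod_(j <- s | j != i) a j.
  have [/allP ap|/allPn[i0 si0 ai0]] := boolP (all (fun i => 0 < a i) s).
    have -> : ln (\prod_(i <- s) a i / \prod_(i <- s) b i) = \sum_(i <- s) ln (a i / b i).
      rewrite -prodfV -big_split /= {key us}.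
      elim: s ap => [|i s ih] ap; first by rewrite !big_nil ln1.
      rewrite !big_cons [LHS]lnM ?posrE ?ih //.
      - by move=> j js; apply: ap; rewrite inE js orbT.
      - by rewrite divr_gt0 // ap // inE eqxx.
      - rewrite big_seq; apply: prodr_gt0 => j js.
        by rewrite divr_gt0 // ap // inE js orbT.
    rewrite mulr_sumr -sum1_size natr_sum mulr_suml -sumrB -big_split /=.
    rewrite [LHS]big_seq [RHS]big_seq; apply: eq_bigr => i si.
    by rewrite (bigD1_seq i si us) /= /gkl; ring.
  have {}ai0 : a i0 = 0 by apply/eqP; move: ai0; rewrite lt_neqAle a0 andbT negbK eq_sym.
  have P0 : \prod_(i <- s) a i = 0 by rewrite (bigD1_seq i0) //= ai0 mul0r.
  rewrite P0 mul0r mulr0 subr0 add0r.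
  rewrite [LHS]big_seq [RHS]big_seq; apply: eq_bigr => i si.
  have [->|ii0] := eqVneq i i0; first by rewrite ai0 gkl0l.
  have -> : \prod_(j <- s | j != i) a j = 0.
    by rewrite (big_rem i0) //= eq_sym ii0 ai0 mul0r.
  by rewrite !mulr0.
rewrite split_gkl /gkl; ring.
Qed.

Lemma measurable_invr : measurable_fun [set: R] (fun x : R => x^-1).
Proof.
(* [powR] is measurable but only meaningful on nonnegative numbers. *)
rewrite (_ : (fun x => _) = (fun x => x * powR (x ^+ 2) (-1))).
  apply: measurable_funM => //.
  exact: (measurableT_comp (measurable_powR (-1)) (exprn_measurable 2)).
apply/funext => x; rewrite powR_inv1 ?sqr_ge0 //.
have [->|x0] := eqVneq x 0; first by rewrite invr0 mul0r.
by field.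
Qed.

Lemma measurable_fun_inv d (T : measurableType d) (D : set T) (f : T -> R) :
  measurable_fun D f -> measurable_fun D (fun x => (f x)^-1).
Proof. by move=> mf; apply: (measurableT_comp measurable_invr). Qed.

Lemma measurable_gkl d (T : measurableType d) (D : set T) (f g : T -> R) :
  measurable_fun D f -> measurable_fun D g ->
  measurable_fun D (fun x => gkl (f x) (g x)).
Proof.
move=> mf mg; apply: measurable_funD => //; apply: measurable_funB => //.
apply: measurable_funM => //; apply: (measurableT_comp (@measurable_ln R)).
by apply: measurable_funM => //; exact: measurable_fun_inv.
Qed.

End gkl.

(** * Densities and integrals *)

Section density.
Context d (T : measurableType d) (R : realType).
Implicit Types mu nu : {measure set T -> \bar R}.

(** Densities are real-valued and nonnegative everywhere, not almost everywhere,
    so that they can be substituted in [ln] and [gkl]. *)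
Definition is_density mu nu (f : T -> R) :=
  [/\ measurable_fun [set: T] f, forall x, 0 <= f x &
      forall A, measurable A -> nu A = (\int[mu]_(x in A) (f x)%:E)%E].

Lemma ex_density (mu : {sigma_finite_measure set T -> \bar R})
    (nu : {finite_measure set T -> \bar R}) :
  nu `<< mu -> exists f, is_density mu nu f.
Proof.
move=> numu; pose f := Radon_Nikodym_SigmaFinite.f nu mu.
have fE x : f x = (fine (f x))%:E.
  by rewrite fineK // Radon_Nikodym_SigmaFinite.f_fin_num.
exists (fine \o f); split.
- apply/measurable_EFinP; rewrite (_ : EFin \o _ = f); last first.
    by apply/funext => x /=; rewrite -fE.
  exact: measurable_int (Radon_Nikodym_SigmaFinite.f_integrable numu).
- by move=> x; rewrite fine_ge0 // Radon_Nikodym_SigmaFinite.f_ge0.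
- move=> A mA; apply: (etrans (Radon_Nikodym_SigmaFinite.f_integral numu mA)).
  by apply: eq_integral => x _; rewrite -/f fE.
Qed.

Lemma density_dominates mu nu f : is_density mu nu f -> nu `<< mu.
Proof.
move=> [mf f0 fE]; apply/null_content_dominatesP => A mA A0.
by rewrite fE // null_set_integral //; exact/measurable_EFinP/measurable_funTS.
Qed.

Lemma density_integrable mu (nu : {finite_measure set T -> \bar R}) f :
  is_density mu nu f -> mu.-integrable [set: T] (EFin \o f).
Proof.
move=> [mf f0 fE]; apply/integrableP; split; first exact/measurable_EFinP.
under eq_integral do rewrite /= ger0_norm //.
by rewrite -fE // -ge0_fin_numE // fin_num_measure.
Qed.

Lemma density_unique mu (nu : {finite_measure set T -> \bar R}) f g :
  is_density mu nu f -> is_density mu nu g -> {ae mu, forall x, f x = g x}.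
Proof.
move=> df [mg g0 gE].
have : ae_eq mu [set: T] (EFin \o f) (EFin \o g).
  apply: integral_ae_eq => //; first exact: density_integrable df.
    exact/measurable_EFinP.
  by case: df => mf f0 fE A _ mA; rewrite -fE // gE.
by apply: filterS => x /(_ I) [].
Qed.

Lemma ge0_integral_density (mu : {sigma_finite_measure set T -> \bar R})
    (nu : {finite_measure set T -> \bar R}) f h A :
  is_density mu nu f -> measurable A -> measurable_fun [set: T] h ->
  (forall x, 0 <= h x)%E ->
  (\int[nu]_(x in A) h x = \int[mu]_(x in A) (h x * (f x)%:E))%E.
Proof.
move=> df mA mh h0; have numu := density_dominates df.
have mhA : measurable_fun A h by exact: measurable_funTS.
rewrite -(Radon_Nikodym_SigmaFinite.change_of_variables numu h0 mA mhA).
have mRN := measurable_int _ (Radon_Nikodym_SigmaFinite.f_integrable numu).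
have [mf f0 fE] := df.
apply: ge0_ae_eq_integral => //.
- by apply: emeasurable_funM => //; exact: measurable_funTS.
- by apply: emeasurable_funM => //; exact/measurable_EFinP/measurable_funTS.
- by move=> x _; rewrite mule_ge0 // Radon_Nikodym_SigmaFinite.f_ge0.
- by move=> x _; rewrite mule_ge0 // lee_fin.
apply: ae_eqe_mul2l; apply: (@ae_eq_subset _ _ _ _ _ setT) => //.
apply: integral_ae_eq => //.
- exact: Radon_Nikodym_SigmaFinite.f_integrable.
- exact/measurable_EFinP.
- move=> E _ mE; apply: (etrans _ (fE _ mE)).
  exact/esym/(Radon_Nikodym_SigmaFinite.f_integral numu mE).
Qed.

Lemma integral_density (mu : {sigma_finite_measure set T -> \bar R})
    (nu : {finite_measure set T -> \bar R}) f h :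
  is_density mu nu f -> measurable_fun [set: T] h ->
  (\int[nu]_x h x = \int[mu]_x (h x * (f x)%:E))%E.
Proof.
move=> df mh; have [mf f0 _] := df.
rewrite integralE [RHS]integralE; congr (_ - _)%E.
- rewrite (ge0_integral_density df) //; last exact: measurable_funepos.
  apply: eq_integral => x _.
  by rewrite !funeposE /= muleC maxe_pMr ?lee_fin // mule0 muleC.
- rewrite (ge0_integral_density df) //; last exact: measurable_funeneg.
  apply: eq_integral => x _.
  by rewrite !funenegE /= muleC maxe_pMr ?lee_fin // mule0 muleN muleC.
Qed.

(** The integral of [f] may be infinite: the negative part of [f + r] is below
    that of [r], so the sum is still unambiguous. *)
Lemma integralD_ge0_integrable (mu : {measure set T -> \bar R}) (f : T -> \bar R) (r : T -> R) :
  measurable_fun [set: T] f -> (forall x, 0 <= f x)%E ->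
  mu.-integrable [set: T] (EFin \o r) ->
  (\int[mu]_x (f x + (r x)%:E) = \int[mu]_x f x + \int[mu]_x (r x)%:E)%E.
Proof.
move=> mf f0 ir.
have [foo|] := ltP (\int[mu]_x f x)%E +oo%E.
  apply: integralD => //; apply/integrableP; split => //.
  by under eq_integral do rewrite gee0_abs //.
rewrite leye_eq => /eqP foo.
have mr := measurable_int _ ir.
have rfin := integrable_fin_num measurableT ir.
rewrite foo addye; last by move: rfin; rewrite fin_numE => /andP[].
set h := (fun x => f x + (r x)%:E)%E.
have mh : measurable_fun [set: T] h by exact: emeasurable_funD.
have ineg := integrable_neg_fin_num measurableT ir.
have hneg : (\int[mu]_x h^\- x < +oo)%E.
  apply: (@le_lt_trans _ _ (\int[mu]_x (EFin \o r)^\- x)%E).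
    apply: ge0_le_integral => //; try exact: measurable_funeneg.
    move=> x _; rewrite !funenegE /h /=.
    rewrite ge_max; apply/andP; split; rewrite le_max; apply/orP; [left|by right].
    have := f0 x; case: (f x) => [s| |] //=; last by rewrite leNye.
    by rewrite !lee_fin => s0; rewrite lerN2 lerDr.
  by rewrite ltey_eq ineg.
have hpos : (\int[mu]_x h^\+ x = +oo)%E.
  have : (\int[mu]_x f x <= \int[mu]_x h^\+ x + \int[mu]_x (EFin \o r)^\- x)%E.
    rewrite -ge0_integralD //; try exact: measurable_funepos; try exact: measurable_funeneg.
    apply: ge0_le_integral => //.
      by apply: emeasurable_funD; [exact: measurable_funepos|exact: measurable_funeneg].
    move=> x _; rewrite funeposE funenegE /h.
    have -> : f x = (f x + (r x)%:E - (r x)%:E)%E by rewrite addeK.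
    by rewrite subeK //; apply: leeD; rewrite le_max lexx.
  rewrite foo leye_eq; move: ineg.
  by case: (\int[mu]_x (EFin \o r)^\- x)%E => // b _; case: (\int[mu]_x h^\+ x)%E.
rewrite integralE hpos addye //.
by move: hneg; case: (\int[mu]_x h^\- x)%E => //= r'.
Qed.
End density.

(** * Kullback-Leibler divergence through densities *)

Section KL.
Local Open Scope charge_scope.
Context d (T : measurableType d) (R : realType).
Implicit Types P Q mu : probability T R.

Lemma integral_density1 (nu : {measure set T -> \bar R}) P a :
  is_density nu P a -> (\int[nu]_x (a x)%:E = 1)%E.
Proof. by move=> [_ _ <-] //; exact: probability_setT. Qed.

Lemma KL_fin_dominates P Q : (KL P Q < +oo)%E -> P `<< Q.
Proof. by rewrite /KL; case: ifPn => [/asboolP//|]; rewrite ltxx. Qed.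

(** [KL] is defined by one version of the Radon-Nikodym derivative; another
    version differs from it on a [Q]-null set only, hence on a [P]-null set. *)
Lemma KL_density P Q f : is_density Q P f -> KL P Q = (\int[P]_x (ln (f x))%:E)%E.
Proof.
move=> df; have PQ := density_dominates df.
rewrite /KL; case: asboolP => // _.
have [mf f0 fE] := df.
have mRN : measurable_fun [set: T] ('d (charge_of_finite_measure P) '/d Q).
  exact: measurable_int (Radon_Nikodym_integrable _).
apply: ae_eq_integral => //.
- apply/measurable_EFinP; apply: (measurableT_comp (@measurable_ln R)).
  by apply: (measurableT_comp _ mRN) => //; exact: fine_measurable.
- by apply/measurable_EFinP; apply: (measurableT_comp (@measurable_ln R)).
apply: (null_dominates_ae_eq measurableT PQ).
have : ae_eq Q [set: T] ('d (charge_of_finite_measure P) '/d Q) (EFin \o f).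
  apply: integral_ae_eq => //.
  - exact: Radon_Nikodym_integrable.
  - exact/measurable_EFinP.
  - by move=> E _ mE; rewrite -fE // -Radon_Nikodym_integral.
by apply: filterS => x /(_ I) /= ->.
Qed.

(** The correction [b - a] in [gkl] integrates to zero. *)
Lemma KL_gkl mu P Q a b : is_density mu P a -> is_density mu Q b ->
  (forall x, 0 < b x) -> KL P Q = (\int[mu]_x (gkl (a x) (b x))%:E)%E.
Proof.
move=> da db b0; have [ma a0 aE] := da; have [mb _ bE] := db.
have mab : measurable_fun [set: T] (fun x => a x / b x).
  by apply: measurable_funM => //; exact: measurable_fun_inv.
have dab : is_density Q P (fun x => a x / b x).
  split => // [x|A mA]; first by rewrite divr_ge0 // ltW.
  rewrite aE // (ge0_integral_density (h := fun x => (a x / b x)%:E) db) //.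
  - by apply: eq_integral => x _; rewrite -EFinM divfK // gt_eqF.
  - exact/measurable_EFinP.
  - by move=> x; rewrite lee_fin divr_ge0 // ltW.
rewrite (KL_density dab) (integral_density da); last first.
  by apply/measurable_EFinP; apply: (measurableT_comp (@measurable_ln R)).
have ia := density_integrable da; have ib := density_integrable db.
have iab : mu.-integrable [set: T] (EFin \o (fun x => a x - b x)).
  rewrite (_ : _ \o _ = (EFin \o a) \- (EFin \o b))%E; first exact: integrableB.
  by apply/funext.
transitivity (\int[mu]_x ((gkl (a x) (b x))%:E + (a x - b x)%:E))%E.
  apply: eq_integral => x _; rewrite -EFinM -EFinD /gkl; congr EFin; ring.
rewrite integralD_ge0_integrable //.
- rewrite [X in (_ + X)%E](_ : _ = 0%E) ?adde0 //.
  under eq_integral do rewrite EFinB.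
  by rewrite integralB // (integral_density1 da) (integral_density1 db) subee.
- by apply/measurable_EFinP; exact: measurable_gkl.
- move=> x; rewrite lee_fin gkl_ge0 //; first exact: ltW.
  by move=> bx0; have := b0 x; rewrite bx0 ltxx.
Qed.

Lemma integral_pos_eq0 (nu : {measure set T -> \bar R}) (f : T -> R) A :
  measurable A -> measurable_fun [set: T] f -> (forall x, A x -> 0 < f x) ->
  (\int[nu]_(x in A) (f x)%:E = 0)%E -> nu A = 0%E.
Proof.
move=> mA mf f0 If.
have mfA : measurable_fun A (EFin \o f) by exact/measurable_EFinP/measurable_funTS.
have : (\int[nu]_(x in A) `|(EFin \o f) x| = 0)%E.
  rewrite -[RHS]If; apply: eq_integral => x /[!inE] Ax.
  by rewrite gee0_abs // lee_fin ltW // f0.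
move=> /(ae_eq_integral_abs nu mA mfA)[M [mM M0 sub]].
apply: (subset_measure0 mA mM _ M0) => x Ax; apply: sub => /= /(_ Ax) [fx0].
by have := f0 _ Ax; rewrite fx0 ltxx.
Qed.

(** Half of the Lebesgue decomposition of [Q] with respect to [mu]: off the
    null set where the density of [mu] with respect to [mu + Q] vanishes, [Q] is
    absolutely continuous. *)
Lemma ex_ac_part mu Q : exists (N : set T) (g : T -> R),
  [/\ measurable N, mu N = 0%E, measurable_fun [set: T] g, forall x, 0 <= g x &
      forall A, measurable A -> Q (A `\` N) = (\int[mu]_(x in A) (g x)%:E)%E].
Proof.
have eta_fin : (measure_add mu Q setT < +oo)%E.
  by rewrite measure_addE; apply: lte_add_pinfty; rewrite (le_lt_trans (probability_le1 _ _)) ?ltry.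
pose eta := mfrestr measurableT eta_fin.
have etaE A : eta A = (mu A + Q A)%E by rewrite /eta /mfrestr /mrestr setIT measure_addE.
have mu_eta : mu `<< eta.
  apply/null_content_dominatesP => A mA etaA.
  have /eqP : (mu A + Q A)%E = 0%E := etrans (esym (etaE A)) etaA.
  by rewrite padde_eq0 ?measure_ge0 // => /andP[/eqP].
have [l [ml l0 lE]] := ex_density mu_eta.
pose N := [set x | l x = 0%R].
have mN : measurable N.
  by rewrite -[X in measurable X]setTI; exact: (ml measurableT [set 0%R]).
have muN : mu N = 0%E.
  by rewrite lE //; apply: integral0_eq => x /= ->.
have mNC := measurableC mN.
have QNmu : mrestr Q mNC `<< mu.
  apply/null_content_dominatesP => A mA muA; rewrite /mrestr -setDE.
  have mA' : measurable (A `\` N) by exact: measurableD.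
  have IA : (\int[eta]_(x in A `\` N) (l x)%:E = 0)%E.
    by rewrite -lE //; apply: (subset_measure0 mA' mA) => //; exact: subDsetl.
  have etaA : eta (A `\` N) = 0%E.
    apply: (integral_pos_eq0 mA' ml _ IA) => x [_ /eqP lx].
    by rewrite lt_neqAle eq_sym lx l0.
  have /eqP : (mu (A `\` N) + Q (A `\` N))%E = 0%E := etrans (esym (etaE _)) etaA.
  by rewrite padde_eq0 ?measure_ge0 // => /andP[_ /eqP].
have [g [mg g0 gE]] := ex_density QNmu.
by exists N, g; split => // A mA; rewrite -gE //= /mrestr setDE.
Qed.

(** A single probability density [q] that does, up to [ln 2], as well as [Q]
    against every law absolutely continuous with respect to [mu].  Halving the
    absolutely continuous part of [Q] leaves room to add a constant that keeps
    [q] away from zero. *)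
Lemma ex_regular_density mu Q : exists q : T -> R,
  [/\ measurable_fun [set: T] q, forall x, 2^-1 <= q x,
      (\int[mu]_x (q x)%:E = 1)%E &
      forall P a, is_density mu P a ->
        (\int[mu]_x (gkl (a x) (q x))%:E <= KL P Q + (ln 2)%:E)%E].
Proof.
have [N [g [mN muN mg g0 gE]]] := ex_ac_part mu Q.
have mgE : measurable_fun [set: T] (EFin \o g) by exact/measurable_EFinP.
have Ig1 : (\int[mu]_x (g x)%:E <= 1)%E.
  by rewrite -gE // probability_le1 //; exact: measurableD.
have Ig0 : (0 <= \int[mu]_x (g x)%:E)%E by apply: integral_ge0 => x _; rewrite lee_fin.
have ig : mu.-integrable [set: T] (EFin \o g).
  apply/integrableP; split => //; under eq_integral do rewrite /= ger0_norm //.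
  exact: (le_lt_trans Ig1 (ltry _)).
pose c := fine (\int[mu]_x (g x)%:E)%E.
have cE : (\int[mu]_x (g x)%:E = c%:E)%E.
  by rewrite fineK // fin_real // (lt_le_trans (ltNyr _) Ig0) (le_lt_trans Ig1 (ltry _)).
have c1 : c <= 1 by rewrite -lee_fin -cE.
have c0 : 0 <= c by rewrite -lee_fin -cE.
pose q x := 2^-1 * g x + (1 - 2^-1 * c).
have mq : measurable_fun [set: T] q.
  by apply: measurable_funD => //; exact: measurable_funM.
have icst : mu.-integrable [set: T] (EFin \o cst (1 - 2^-1 * c)).
  exact: finite_measure_integrable_cst.
have q2 x : 2^-1 <= q x by rewrite /q; have := g0 x; lra.
have q1 : (\int[mu]_x (q x)%:E = 1)%E.
  under eq_integral do rewrite EFinD EFinM.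
  rewrite integralD //; last exact: integrableZl.
  rewrite integralZl // cE integral_cst //= probability_setT mule1 -EFinM -EFinD.
  by congr EFin; lra.
have iq : mu.-integrable [set: T] (EFin \o q).
  apply/integrableP; split; first exact/measurable_EFinP.
  under eq_integral => x _.
    rewrite /= ger0_norm; last by rewrite (le_trans _ (q2 x)).
    over.
  by rewrite q1 ltry.
exists q; split => // P a da.
have [PQ|nPQ] := pselect (P `<< Q); last first.
  by rewrite /KL; case: asboolP => // _; rewrite addye // leey.
have [f df] := ex_density PQ; have [mf f0 fE] := df.
have [ma a0 aE] := da.
have PN : P N = 0%E by rewrite aE // null_set_integral //; exact/measurable_EFinP/measurable_funTS.
have dfg : is_density mu P (fun x => f x * g x).
  split => [|x|A mA]; [exact: measurable_funM|by rewrite mulr_ge0|].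
  have mAN : measurable (A `\` N) by exact: measurableD.
  have mNC := measurableC mN.
  have dg : is_density mu (mrestr Q mNC) g.
    by split => // B mB; rewrite -gE // /mrestr setDE.
  transitivity (P (A `\` N)).
    have PAN := subset_measure0 (measurableI _ _ mA mN) mN (@subIsetr _ A N) PN.
    by apply: (etrans (measureDI P mA mN)); rewrite [X in (_ + X)%E]PAN adde0.
  rewrite fE // (@eq_measure_integral _ _ _ _ (mrestr Q mNC)); last first.
    move=> B mB BAN; rewrite /mrestr; congr (Q _); apply/seteqP; split => [x Bx|x []//].
    by split => //; have [] := BAN _ Bx.
  rewrite (ge0_integral_density (h := EFin \o f) dg) //; last exact/measurable_EFinP.
  rewrite -ge0_negligible_integral //.
  apply: emeasurable_funM; apply/measurable_EFinP; exact: measurable_funTS.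
  by move=> x _; rewrite mule_ge0 // lee_fin.
have a_fg := density_unique da dfg.
pose r x := a x * ln 2 - a x + q x.
pose h x := ln (f x) * a x.
have mlnf : measurable_fun [set: T] (fun x => ln (f x)).
  exact: (measurableT_comp (@measurable_ln R)).
have mh : measurable_fun [set: T] h by exact: measurable_funM.
have mr : measurable_fun [set: T] r.
  by apply: measurable_funD => //; apply: measurable_funB => //; exact: measurable_funM.
have mk : measurable_fun [set: T] (fun x => gkl (a x) (q x)) by exact: measurable_gkl.
have q0 x : 0 < q x by rewrite (lt_le_trans _ (q2 x)).
have gkl0 x : 0 <= gkl (a x) (q x).
  by apply: gkl_ge0 => // [|qx0]; [exact: ltW|have := q0 x; rewrite qx0 ltxx].
have ia := density_integrable da.
have ir : mu.-integrable [set: T] (EFin \o r).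
  rewrite (_ : _ \o _ = (fun x => (ln 2)%:E * (a x)%:E - (a x)%:E + (q x)%:E))%E.
    apply: integrableD => //; apply: integrableB => //; exact: integrableZl.
  by apply/funext => x; rewrite /r /= mulrC.
have Ir : (\int[mu]_x (r x)%:E = (ln 2)%:E)%E.
  transitivity (\int[mu]_x ((ln 2)%:E * (a x)%:E - (a x)%:E + (q x)%:E))%E.
    by apply: eq_integral => x _; rewrite /r mulrC.
  rewrite integralD //; last by apply: integrableB => //; exact: integrableZl.
  rewrite integralB //; last exact: integrableZl.
  by rewrite integralZl // q1 (integral_density1 da) mule1 subeK.
(* Where [a] and [f] vanish the junk value of [ln] is multiplied by [0]. *)
have le_h : {ae mu, forall x, gkl (a x) (q x) <= h x + r x}.
  apply: filterS a_fg => x afg.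
  have := a0 x; rewrite le_eqVlt => /orP[/eqP ax0|ax0].
    by rewrite /h /r -ax0 gkl0l mulr0 mul0r subr0 !add0r.
  have fg0 : 0 < f x * g x by rewrite -afg.
  have fx : 0 < f x.
    by rewrite lt_neqAle f0 andbT; apply: contraTneq fg0 => <-; rewrite mul0r ltxx.
  have gx : 0 < g x by rewrite -(pmulr_rgt0 _ fx).
  suff : ln (a x / q x) <= ln (2 * f x).
    rewrite [leRHS]lnM ?posrE // => /(ler_wpM2l (ltW ax0)); rewrite /gkl /h /r; lra.
  have aq0 : 0 < a x / q x by rewrite divr_gt0 ?q0.
  rewrite ler_ln ?posrE // ?ler_pdivrMr ?afg //; last exact: mulr_gt0.
  rewrite -mulrA mulrCA ler_pM2l // -(ler_pM2l (_ : 0 < 2^-1)) // mulrA mulVf // mul1r.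
  by rewrite /q; lra.
pose phi x := Num.max (h x + r x) (gkl (a x) (q x)).
have mphi : measurable_fun [set: T] phi.
  by apply: measurable_maxr => //; exact: measurable_funD.
have KLE : (KL P Q = \int[mu]_x ((phi x)%:E + (- r x)%:E))%E.
  rewrite (KL_density df) (integral_density da); last exact/measurable_EFinP.
  apply: ae_eq_integral => //.
  - exact/measurable_EFinP.
  - by apply/measurable_EFinP/measurable_funD => //; exact: measurable_funN.
  apply: filterS le_h => x lx _.
  by rewrite /phi (elimT max_idPl lx) -EFinM -EFinD addrK.
rewrite KLE integralD_ge0_integrable //; last 3 first.
- exact/measurable_EFinP.
- by move=> x; rewrite lee_fin le_max gkl0 orbT.
- rewrite (_ : _ \o _ = (fun x => - (r x)%:E))%E; first exact: integrableN.
  by apply/funext.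
rewrite [X in (_ + X + _)%E](_ : _ = - (ln 2)%:E)%E; last first.
  by under eq_integral do rewrite EFinN; rewrite integralN ?Ir // integrable_add_def.
rewrite subeK //; apply: ge0_le_integral => //.
- by move=> x _; rewrite lee_fin.
- exact/measurable_EFinP.
- exact/measurable_EFinP.
- by move=> x _; rewrite lee_fin le_max lexx orbT.
Qed.
End KL.

(** * Power measures on tuples *)

Section tuple_measurability.
Context d (T : measurableType d).

Lemma measurable_fun_of_nth d' (U : measurableType d') n (f : U -> n.-tuple T) (x0 : T) :
  (forall i, (i < n)%N -> measurable_fun [set: U] (fun u => nth x0 (f u) i)) ->
  measurable_fun [set: U] f.
Proof.
move=> mf; apply/measurable_fun_tnthP => i.
have := mf i (ltn_ord i); apply: eq_measurable_fun => u _ /=.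
by rewrite (tnth_nth x0).
Qed.

Lemma measurable_nth n (x0 : T) i : measurable_fun [set: n.-tuple T] (fun w => nth x0 w i).
Proof.
have [ni|lein] := ltnP i n; last first.
  apply: (eq_measurable_fun (cst x0)) => [w _ /=|]; last exact: measurable_cst.
  by rewrite nth_default ?size_tuple.
apply: (eq_measurable_fun (fun w => tnth w (Ordinal ni))); last exact: measurable_tnth.
by move=> w _; rewrite (tnth_nth x0).
Qed.

Lemma measurable_cat_tuple n m :
  measurable_fun [set: n.-tuple T * m.-tuple T] (fun p => cat_tuple p.1 p.2).
Proof.
apply: (measurable_fun_of_nth (x0 := point)) => i inm.
have [ni|lein] := ltnP i n.
  rewrite (_ : (fun u => _) = (fun p => nth point (p.1 : n.-tuple T) i)).
    exact: (measurableT_comp (measurable_nth point i) measurable_fst).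
  by apply/funext => p /=; rewrite nth_cat size_tuple ni.
rewrite (_ : (fun u => _) = (fun p => nth point (p.2 : m.-tuple T) (i - n))).
  exact: (measurableT_comp (measurable_nth point (i - n)) measurable_snd).
by apply/funext => p /=; rewrite nth_cat size_tuple ltnNge lein.
Qed.

Definition rcons_pair n (p : n.-tuple T * T) : n.+1.-tuple T := rcons_tuple p.1 p.2.

Lemma measurable_rcons_pair n : measurable_fun [set: n.-tuple T * T] (@rcons_pair n).
Proof.
apply: (measurable_fun_of_nth (x0 := point)) => i.
rewrite ltnS leq_eqVlt => /predU1P[->|ni].
  rewrite (_ : (fun u => _) = snd); first exact: measurable_snd.
  by apply/funext => p /=; rewrite nth_rcons size_tuple ltnn eqxx.
rewrite (_ : (fun u => _) = (fun p => nth point (p.1 : n.-tuple T) i)).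
  exact: (measurableT_comp (measurable_nth point i) measurable_fst).
by apply/funext => p /=; rewrite nth_rcons size_tuple ni.
Qed.

HB.instance Definition _ n :=
  isMeasurableFun.Build _ _ _ _ (@rcons_pair n) (@measurable_rcons_pair n).

(** A function of sequences of any length stands for a family of functions of
    tuples, so that appending letters and splitting sequences need no cast
    between tuple types. *)
Definition seq_measurable d' (U : measurableType d') (f : seq T -> U) :=
  forall n, measurable_fun [set: n.-tuple T] (fun w => f (tval w)).

Lemma seq_measurable_rcons2 d' (U : measurableType d') (f : seq T -> U) n :
  seq_measurable f ->
  measurable_fun [set: n.-tuple T * T] (fun p => f (rcons p.1 p.2)).
Proof. by move=> mf; exact: (measurableT_comp (mf n.+1) (@measurable_rcons_pair n)). Qed.

Lemma seq_measurable_cat2 d' (U : measurableType d') (f : seq T -> U) n m :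
  seq_measurable f ->
  measurable_fun [set: n.-tuple T * m.-tuple T] (fun p => f (tval p.1 ++ tval p.2)).
Proof. by move=> mf; exact: (measurableT_comp (mf (n + m)%N) (@measurable_cat_tuple n m)). Qed.

Lemma seq_measurable_rcons d' (U : measurableType d') (f : seq T -> U) n (w : n.-tuple T) :
  seq_measurable f -> measurable_fun [set: T] (fun y => f (rcons w y)).
Proof.
move=> /(@seq_measurable_rcons2 _ _ _ n) mf.
exact: (measurableT_comp mf (pair1_measurable w)).
Qed.

Lemma seq_measurable_rconsl d' (U : measurableType d') (f : seq T -> U) (y : T) :
  seq_measurable f -> seq_measurable (fun w => f (rcons w y)).
Proof.
move=> mf n; exact: (measurableT_comp (seq_measurable_rcons2 (n := n) mf) (pair2_measurable y)).
Qed.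

Lemma seq_measurable_cat d' (U : measurableType d') (f : seq T -> U) n (u : n.-tuple T) :
  seq_measurable f -> seq_measurable (fun v => f (tval u ++ v)).
Proof.
move=> mf m.
exact: (measurableT_comp (seq_measurable_cat2 (n := n) (m := m) mf) (pair1_measurable u)).
Qed.

End tuple_measurability.

Section tpow.
Context d (T : measurableType d) (R : realType).
Implicit Types mu P : probability T R.

(** The power grows at its end because the last letter is the one to forecast
    given the others. *)
Fixpoint tpow mu n : probability (n.-tuple T) R :=
  match n with
  | 0 => dirac [tuple]
  | m.+1 => distribution (tpow mu m \x mu)%E (@rcons_pair d T m)
  end.

Lemma ge0_integral_tpowS mu n (f : n.+1.-tuple T -> \bar R) :
  measurable_fun [set: n.+1.-tuple T] f -> (forall w, 0 <= f w)%E ->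
  (\int[tpow mu n.+1]_w f w = \int[tpow mu n]_w \int[mu]_y f (rcons_tuple w y))%E.
Proof.
move=> mf f0 /=; rewrite ge0_integral_distribution // fubini_tonelli1 //.
  by apply: measurableT_comp => //; exact: measurable_rcons_pair.
by move=> p; exact: f0.
Qed.

Lemma tpow_box mu n (B : 'I_n -> set T) : (forall i, measurable (B i)) ->
  tpow mu n [set w | forall i, B i (tnth w i)] = (\prod_(i < n) mu (B i))%E.
Proof.
elim: n B => [|n ih] B mB.
  by rewrite big_ord0 /= diracE mem_set // => -[].
rewrite big_ord_recr /= /distribution /pushforward.
rewrite (_ : _ @^-1` _ = [set w : n.-tuple T | forall i : 'I_n, B (widen_ord (leqnSn n) i) (tnth w i)] `*` B ord_max).
  rewrite product_measure1E //; first by congr (_ * _)%E; exact: ih.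
  rewrite (_ : [set w | _] = \bigcap_(i in [set: 'I_n]) (fun w : n.-tuple T => tnth w i) @^-1` B (widen_ord (leqnSn n) i)).
    apply: fin_bigcap_measurable => // i _; rewrite -[X in measurable X]setTI.
    by apply: measurable_tnth.
  by apply/seteqP; split => [w h i _|w h i]; [exact: h|exact: (h i)].
apply/seteqP; split => [[w y] /= h|[w y] /= [h hy] i].
  split=> [i|].
    by have := h (widen_ord (leqnSn n) i); rewrite !(tnth_nth y) /= nth_rcons size_tuple ltn_ord.
  by have := h ord_max; rewrite (tnth_nth y) /= nth_rcons size_tuple ltnn eqxx.
have [ni|] := ltnP i n.
  have := h (Ordinal ni); rewrite !(tnth_nth y) /= nth_rcons size_tuple ni.
  by rewrite (_ : widen_ord _ _ = i) //; apply/val_inj.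
move=> lein; have ei : i = ord_max.
  by apply/val_inj => /=; apply/eqP; rewrite eqn_leq lein -ltnS ltn_ord.
by rewrite ei (tnth_nth y) /= nth_rcons size_tuple ltnn eqxx.
Qed.

Lemma tpow_iid mu n : is_iid_law mu (tpow mu n).
Proof. by move=> B mB; exact: tpow_box. Qed.

End tpow.

(** * Integrals of functions of sequences *)

Section tint.
Context d (T : measurableType d) (R : realType).
Implicit Types (mu P : probability T R) (f g : seq T -> \bar R).

Definition tint mu n f := (\int[tpow mu n]_w f (tval w))%E.

Lemma tint0 mu f : seq_measurable f -> (forall s, 0 <= f s)%E -> tint mu 0 f = f [::].
Proof.
move=> mf f0; rewrite /tint /= integral_dirac //; last exact: (mf 0%N).
by rewrite diracT mul1e.
Qed.

Lemma tintS mu n f : seq_measurable f -> (forall s, 0 <= f s)%E ->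
  tint mu n.+1 f = tint mu n (fun w => \int[mu]_y f (rcons w y))%E.
Proof. by move=> mf f0; rewrite /tint ge0_integral_tpowS //; exact: mf. Qed.

Lemma seq_measurable_integral mu f : seq_measurable f -> (forall s, 0 <= f s)%E ->
  seq_measurable (fun w => \int[mu]_y f (rcons w y))%E.
Proof.
move=> mf f0 n.
apply: (measurable_fun_fubini_tonelli_F (fun p : n.-tuple T * T => f (rcons p.1 p.2))) => //.
exact: seq_measurable_rcons2.
Qed.

Lemma tintSl mu n f : seq_measurable f -> (forall s, 0 <= f s)%E ->
  tint mu n.+1 f = (\int[mu]_y tint mu n (fun w => f (rcons w y)))%E.
Proof.
move=> mf f0; rewrite tintS // /tint.
apply: (fubini_tonelli (fun p : n.-tuple T * T => f (rcons p.1 p.2))) => //.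
exact: seq_measurable_rcons2.
Qed.

Lemma measurable_tint_rcons mu n f : seq_measurable f -> (forall s, 0 <= f s)%E ->
  measurable_fun [set: T] (fun y => tint mu n (fun w => f (rcons w y))).
Proof.
move=> mf f0.
apply: (measurable_fun_fubini_tonelli_G (fun p : n.-tuple T * T => f (rcons p.1 p.2))) => //.
exact: seq_measurable_rcons2.
Qed.

Lemma seq_measurable_tint mu m f : seq_measurable f -> (forall s, 0 <= f s)%E ->
  seq_measurable (fun u => tint mu m (fun v => f (u ++ v))).
Proof.
move=> mf f0 n.
apply: (measurable_fun_fubini_tonelli_F (fun p : n.-tuple T * m.-tuple T => f (tval p.1 ++ tval p.2))) => //.
exact: seq_measurable_cat2.
Qed.

Lemma tint_ge0 mu n f : (forall s, 0 <= f s)%E -> (0 <= tint mu n f)%E.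
Proof. by move=> f0; apply: integral_ge0. Qed.

Lemma eq_tint mu n f g : (forall s, size s = n -> f s = g s) -> tint mu n f = tint mu n g.
Proof. by move=> fg; apply: eq_integral => w _; rewrite fg ?size_tuple. Qed.

Lemma le_tint mu n f g : seq_measurable f -> seq_measurable g -> (forall s, 0 <= f s)%E ->
  (forall s, size s = n -> f s <= g s)%E -> (tint mu n f <= tint mu n g)%E.
Proof.
move=> mf mg f0 fg; apply: ge0_le_integral => //; [exact: mf|exact: mg|].
by move=> w _; apply: fg; rewrite size_tuple.
Qed.

Lemma tint_cat mu n m f : seq_measurable f -> (forall s, 0 <= f s)%E ->
  tint mu (n + m) f = tint mu n (fun u => tint mu m (fun v => f (u ++ v))).
Proof.
elim: m f => [|m ih] f mf f0.
  rewrite addn0; apply: eq_integral => u _.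
  rewrite tint0 ?cats0 //; exact: seq_measurable_cat.
rewrite addnS tintS // ih //; last 2 first.
- exact: seq_measurable_integral.
- by move=> s; apply: integral_ge0.
apply: eq_integral => u _; rewrite tintS //; last exact: seq_measurable_cat.
by apply: eq_tint => v _; apply: eq_integral => y _; rewrite rcons_cat.
Qed.

Lemma tintD mu n f g : seq_measurable f -> seq_measurable g ->
  (forall s, 0 <= f s)%E -> (forall s, 0 <= g s)%E ->
  tint mu n (fun s => f s + g s)%E = (tint mu n f + tint mu n g)%E.
Proof. by move=> mf mg f0 g0; rewrite /tint ge0_integralD //; [exact: mf|exact: mg]. Qed.

Lemma tintZ mu n f (c : R) : seq_measurable f -> (forall s, 0 <= f s)%E -> 0 <= c ->
  tint mu n (fun s => c%:E * f s)%E = (c%:E * tint mu n f)%E.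
Proof. by move=> mf f0 c0; rewrite /tint ge0_integralZl //; exact: mf. Qed.

Lemma tint_sum mu n (I : Type) (s : seq I) (f : I -> seq T -> \bar R) :
  (forall i, seq_measurable (f i)) -> (forall i w, 0 <= f i w)%E ->
  tint mu n (fun w => \sum_(i <- s) f i w)%E = (\sum_(i <- s) tint mu n (f i))%E.
Proof. by move=> mf f0; rewrite /tint ge0_integral_sum // => i; exact: mf. Qed.

Lemma tint_cst mu n (c : R) : tint mu n (fun=> c%:E) = c%:E.
Proof.
rewrite /tint integral_cst // -[RHS]mule1.
by congr (_ * _)%E; exact: probability_setT.
Qed.

(** Reading a sequence through a fixed list of positions reduces the
    measurability of masks, prefixes and suffixes to that of coordinates. *)
Lemma seq_measurable_sel d' (U : measurableType d') (f : seq T -> U) n (x0 : T) (l : seq nat) :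
  seq_measurable f ->
  measurable_fun [set: n.-tuple T] (fun w => f [seq nth x0 w i | i <- l]).
Proof.
move=> mf; have := mf (size l) => mfl.
pose sel (w : n.-tuple T) : (size l).-tuple T := map_tuple (nth x0 w) (in_tuple l).
have msel : measurable_fun [set: n.-tuple T] sel.
  apply: (measurable_fun_of_nth (x0 := x0)) => i il /=.
  rewrite (_ : (fun u => _) = (fun w : n.-tuple T => nth x0 w (nth 0%N l i))); first exact: measurable_nth.
  by apply/funext => w; rewrite (nth_map 0%N).
exact: (measurableT_comp mfl msel).
Qed.

Lemma mask_sel (x0 : T) (m : bitseq) (w : seq T) :
  mask m w = [seq nth x0 w i | i <- mask m (iota 0 (size w))].
Proof.
by rewrite map_mask; congr mask; rewrite -/(mkseq _ _) mkseq_nth.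
Qed.

Lemma seq_measurable_mask d' (U : measurableType d') (f : seq T -> U) (m : bitseq) :
  seq_measurable f -> seq_measurable (fun w => f (mask m w)).
Proof.
move=> mf n; rewrite (_ : (fun w => _) = (fun w : n.-tuple T => f [seq nth point w i | i <- mask m (iota 0 n)])).
  exact: seq_measurable_sel.
by apply/funext => w; rewrite (mask_sel point) size_tuple.
Qed.

Lemma seq_measurable_drop d' (U : measurableType d') (f : seq T -> U) m :
  seq_measurable f -> seq_measurable (fun w => f (drop m w)).
Proof.
move=> mf n; rewrite (_ : (fun w => _) = (fun w : n.-tuple T => f [seq nth point w i | i <- drop m (iota 0 n)])).
  exact: seq_measurable_sel.
apply/funext => w; rewrite map_drop; congr (f (drop m _)).
by rewrite -[LHS](mkseq_nth point) size_tuple.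
Qed.

Lemma seq_measurable_EFin (f : seq T -> R) :
  seq_measurable f -> seq_measurable (fun s => (f s)%:E).
Proof. by move=> mf n; apply/measurable_EFinP; exact: mf. Qed.

Lemma seq_measurable_prod (e : T -> R) : measurable_fun [set: T] e ->
  seq_measurable (fun s => \prod_(y <- s) e y).
Proof.
move=> me n.
rewrite (_ : (fun w => _) = (fun w : n.-tuple T => \prod_(i < n) e (tnth w i))).
  apply: measurable_prod => i _.
  by apply: (measurableT_comp me); exact: measurable_tnth.
by apply/funext => w; rewrite big_tuple.
Qed.

(** The density of a power law is the product of the densities of its letters,
    by Tonelli's theorem on the indicator of [A]. *)
Lemma tpow_density mu P e n : is_density mu P e ->
  is_density (tpow mu n) (tpow P n) (fun w => \prod_(y <- tval w) e y).
Proof.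
move=> de; have [me e0 _] := de.
have mpe := seq_measurable_prod me.
split; first exact: mpe.
  by move=> w; apply: prodr_ge0.
elim: n => [|n ih] A mA.
  rewrite integral_dirac //=; last first.
    by apply: measurable_funTS; apply/measurable_EFinP; exact: mpe.
  by rewrite big_nil mule1.
have dn : is_density (tpow mu n) (tpow P n) (fun w => \prod_(y <- tval w) e y).
  by split => //; [exact: mpe|move=> w; apply: prodr_ge0].
pose F (w : n.+1.-tuple T) := (\1_A w)%:E : \bar R.
have mF : measurable_fun [set: n.+1.-tuple T] F.
  by apply/measurable_EFinP; exact: measurable_indic.
have F0 w : (0 <= F w)%E by rewrite lee_fin.
transitivity (\int[tpow P n.+1]_w F w)%E.
  by rewrite integral_indic // setIT.
have mFr : measurable_fun [set: n.-tuple T * T] (fun p => F (rcons_tuple p.1 p.2)).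
  by apply: (measurableT_comp mF); exact: measurable_rcons_pair.
rewrite ge0_integral_tpowS // (ge0_integral_density dn) //; last 2 first.
- exact: (measurable_fun_fubini_tonelli_F (fun p : n.-tuple T * T => F (rcons_tuple p.1 p.2))).
- by move=> w; apply: integral_ge0.
rewrite integral_mkcond.
transitivity (\int[tpow mu n.+1]_w (F w * (\prod_(y <- tval w) e y)%:E))%E; last first.
  apply: eq_integral => w _; rewrite /F epatch_indic muleC //.
rewrite ge0_integral_tpowS //; last 2 first.
- apply: emeasurable_funM => //; exact: (seq_measurable_EFin mpe).
- by move=> w; rewrite mule_ge0 // lee_fin; apply: prodr_ge0.
apply: eq_integral => w _.
have mFw : measurable_fun [set: T] (fun y => F (rcons_tuple w y)).
  exact: (measurableT_comp mFr (pair1_measurable w)).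
rewrite (ge0_integral_density (h := fun y => F (rcons_tuple w y)) de) //.
rewrite -ge0_integralZr //; last 3 first.
- by apply: emeasurable_funM => //; exact/measurable_EFinP.
- by move=> y _; rewrite mule_ge0 // lee_fin.
- by rewrite lee_fin; apply: prodr_ge0.
by apply: eq_integral => y _ /=; rewrite big_rcons /= -muleA -!EFinM [e y * _]mulrC.
Qed.
End tint.

Section blocks.
Context d (T : measurableType d) (R : realType) (k : nat).
Implicit Types (mu : probability T R) (z : seq 'I_k) (h : 'I_k -> seq T -> \bar R).

(** The letters of [x] emitted in state [i] when [z] is the hidden path. *)
Definition block U z (x : seq U) (i : 'I_k) := mask [seq j == i | j <- z] x.

Lemma block_rcons U z (x : seq U) j y i : size x = size z ->
  block (rcons z j) (rcons x y) i =
  if i == j then rcons (block z x i) y else block z x i.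
Proof.
move=> sx; rewrite /block map_rcons mask_rcons ?size_map // [j == i]eq_sym.
by case: eqP => _; rewrite ?cats1 ?cats0.
Qed.

Lemma seq_measurable_blocks z h : (forall i, seq_measurable (h i)) ->
  seq_measurable (fun x => \prod_(i < k) h i (block z x i))%E.
Proof.
move=> mh n; have mb i : measurable_fun [set: n.-tuple T] (fun x => h i (block z (tval x) i)).
  exact: (@seq_measurable_mask _ _ _ _ (h i) [seq j == i | j <- z] (mh i) n).
elim: (index_enum _) => [|i s ih].
  by under eq_fun do rewrite big_nil; exact: measurable_cst.
by under eq_fun do rewrite big_cons; exact: emeasurable_funM.
Qed.

(** Disjoint blocks of coordinates are independent under a power measure: the
    last coordinate belongs to exactly one block, and integrating it out
    shortens that block by one letter. *)
Lemma tint_blocks mu z h :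
  (forall i, seq_measurable (h i)) -> (forall i s, 0 <= h i s)%E ->
  (tint mu (size z) (fun x => \prod_(i < k) h i (block z x i)) =
   \prod_(i < k) tint mu (count_mem i z) (h i))%E.
Proof.
elim/last_ind: z h => [|z j ih] h mh h0.
  rewrite tint0 /=; first by apply: eq_bigr => i _; rewrite tint0.
    exact: seq_measurable_blocks.
  by move=> s; apply: prode_ge0.
rewrite size_rcons tintSl; last 2 first.
- exact: seq_measurable_blocks.
- by move=> s; apply: prode_ge0.
pose h' y i s := if i == j then h i (rcons s y) else h i s.
have h'0 y i s : (0 <= h' y i s)%E by rewrite /h'; case: ifP.
have mh' y i : seq_measurable (h' y i).
  by rewrite /h'; case: (i == j) => //; exact: seq_measurable_rconsl.
transitivity (\int[mu]_y \prod_(i < k) tint mu (count_mem i z) (h' y i))%E.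
  apply: eq_integral => y _; rewrite -ih //; apply: eq_tint => s ss.
  apply: eq_bigr => i _; rewrite block_rcons // /h'.
  by case: ifP.
rewrite (bigD1 j) //=; under eq_integral do rewrite (bigD1 j) //=.
pose C := (\prod_(i < k | i != j) tint mu (count_mem i z) (h i))%E.
have C0 : (0 <= C)%E by apply: prode_ge0 => i _; exact: tint_ge0.
transitivity (\int[mu]_y (tint mu (count_mem j z) (fun w => h j (rcons w y)) * C))%E.
  apply: eq_integral => y _; congr (_ * _)%E; first by rewrite /h' eqxx.
  by apply: eq_bigr => i ij; rewrite /h' (negbTE ij).
rewrite ge0_integralZr //; last 2 first.
- exact: measurable_tint_rcons.
- by move=> y _; exact: tint_ge0.
rewrite -tintSl //; congr (_ * _)%E.
  by rewrite -cats1 count_cat /= eqxx addn0 addn1.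
by apply: eq_bigr => i ij; rewrite -cats1 count_cat /= eq_sym (negbTE ij) !addn0.
Qed.

End blocks.

(** * Coding the observations of each state separately *)

Section glue.
Context {T U : Type}.

(** Codes are chosen for each length separately; gluing them yields one function
    of sequences. *)
Definition glue_tuples (q : forall n, n.-tuple T -> U) (s : seq T) : U :=
  q (size s) (in_tuple s).

Lemma glue_tuplesE (q : forall n, n.-tuple T -> U) n (w : n.-tuple T) :
  glue_tuples q w = q n w.
Proof.
case: w => s sn; rewrite /glue_tuples /=; move: (eqP sn) => e; subst n.
by congr q; exact/val_inj.
Qed.

End glue.

Section block_density.
Context d (T : measurableType d) (R : realType).
Implicit Types (mu P : probability T R) (Qs : set (probability T R)).

(** The slack [1] is needed as the infimum may not be attained. *)
Lemma Red_witness d' (U : measurableType d') (C : set (probability U R)) (r : R) :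
  (Red C <= r%:E)%E -> exists Q, forall L, C L -> (KL L Q <= (r + 1)%:E)%E.
Proof.
move=> Cr.
have : (Red C < (r + 1)%:E)%E.
  by apply: le_lt_trans Cr _; rewrite lte_fin ltrDl.
move=> /ereal_inf_lt[_ [Q _ <-] sQ]; exists Q => L CL.
by apply: le_trans (ltW sQ); apply: ereal_sup_ubound; exists L.
Qed.

(** A law whose divergence to [Q] is finite is dominated by [Q]; finite
    redundancy of a single observation thus provides one reference law for the
    whole class. *)
Lemma ex_base_measure Qs (rho : R -> R) :
  (forall t : nat, (Red (iid_class Qs t) <= (rho t%:R)%:E)%E) ->
  exists mu, forall P, Qs P -> P `<< mu.
Proof.
move=> /(_ 1%N)/Red_witness[Q hQ].
have m0 : measurable_fun [set: 1.-tuple T] (fun w => tnth w ord0) by exact: measurable_tnth.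
pose X : {mfun 1.-tuple T >-> T} := HB.pack (fun w : 1.-tuple T => tnth w ord0)
  (isMeasurableFun.Build _ _ _ _ _ m0).
exists (distribution Q X) => P QP.
have : (KL (tpow P 1) Q <= (rho 1%:R + 1)%:E)%E by apply: hQ; exists P => //; exact: tpow_iid.
move=> /le_lt_trans/(_ (ltry _))/KL_fin_dominates/null_content_dominatesP PQ.
apply/null_content_dominatesP => A mA QA.
have mXA : measurable (X @^-1` A).
  by rewrite -[Y in measurable Y]setTI; exact: (measurable_tnth ord0 measurableT mA).
have := PQ _ mXA QA.
have -> : X @^-1` A = [set w | forall i : 'I_1, A (tnth w i)].
  by apply/seteqP; split => [w /= Aw i|w]; [rewrite (ord1 i)|exact].
by move=> h; have := tpow_box P (fun _ : 'I_1 => mA); rewrite big_ord1 => <-.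
Qed.

(** Near-optimal codes for i.i.d. blocks of all lengths, as densities bounded away
    from zero. *)
Lemma ex_block_density Qs (rho : R -> R) mu :
  (forall t : nat, (Red (iid_class Qs t) <= (rho t%:R)%:E)%E) ->
  exists q : seq T -> R,
  [/\ seq_measurable q, forall s, 2^-1 <= q s,
      forall n, tint mu n (fun s => (q s)%:E) = 1%E &
      forall P e n, Qs P -> is_density mu P e ->
        (tint mu n (fun s => (gkl (\prod_(y <- s) e y) (q s))%:E) <= (rho n%:R + 1 + ln 2)%:E)%E].
Proof.
move=> hRed.
have step n : exists q : n.-tuple T -> R,
  [/\ measurable_fun [set: n.-tuple T] q, forall x, 2^-1 <= q x,
      (\int[tpow mu n]_x (q x)%:E = 1)%E &
      forall P e, Qs P -> is_density mu P e ->
        (\int[tpow mu n]_w (gkl (\prod_(y <- tval w) e y) (q w))%:E <= (rho n%:R + 1 + ln 2)%:E)%E].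
  have [Q hQ] := Red_witness (hRed n).
  have [q [mq q2 q1 hq]] := ex_regular_density (tpow mu n) Q.
  exists q; split => // P e QP de.
  apply: le_trans (hq _ _ (tpow_density n de)) _.
  by rewrite EFinD leeD2r // hQ //; exists P => //; exact: tpow_iid.
pose q n := projT1 (cid (step n)).
have qP n := projT2 (cid (step n)).
exists (glue_tuples q); split.
- move=> n; have [mq _ _ _] := qP n.
  by rewrite (_ : (fun w => _) = q n) //; apply/funext => w; rewrite glue_tuplesE.
- by move=> s; have [_ q2 _ _] := qP (size s); exact: q2.
- move=> n; have [_ _ q1 _] := qP n; rewrite -[RHS]q1.
  by apply: eq_integral => w _; rewrite glue_tuplesE.
- move=> P e n QP de; have [_ _ _ hq] := qP n; apply: le_trans (hq P e QP de).
  by rewrite le_eqVlt; apply/orP; left; apply/eqP; apply: eq_integral => w _; rewrite glue_tuplesE.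
Qed.

Lemma tint_prod_density mu P e n : is_density mu P e ->
  tint mu n (fun s => (\prod_(y <- s) e y)%:E) = 1%E.
Proof. by move=> /(tpow_density n)/integral_density1. Qed.

End block_density.

Section path_density.
Context d (T : measurableType d) (R : realType) (k : nat).
Variables (mu : probability T R) (e : 'I_k -> T -> R) (q : seq T -> R).
Implicit Types (z : seq 'I_k) (x : seq T).

(** Given the hidden path, the letters emitted in distinct states are independent
    blocks; [path_emission] is the density of the observations grouped in this
    way, and [path_coding] replaces the law of each block by its code. *)
Definition path_emission z x := \prod_(i < k) \prod_(y <- block z x i) e i y.
Definition path_coding z x := \prod_(i < k) q (block z x i).

Hypotheses (me : forall i, measurable_fun [set: T] (e i)) (e0 : forall i y, 0 <= e i y).
Hypotheses (e1 : forall i n, tint mu n (fun s => (\prod_(y <- s) e i y)%:E) = 1%E).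
Hypotheses (mq : seq_measurable q) (q0 : forall s, 0 < q s).
Hypothesis (q1 : forall n, tint mu n (fun s => (q s)%:E) = 1%E).

(** KL divergence adds up over independent blocks; see [gkl_tensor], whose
    terms are nonnegative and integrate block by block. *)
Lemma tint_gkl_path z :
  (tint mu (size z) (fun x => (gkl (path_emission z x) (path_coding z x))%:E) =
   \sum_(i < k) tint mu (count_mem i z) (fun s => (gkl (\prod_(y <- s) e i y) (q s))%:E))%E.
Proof.
pose a i s := \prod_(y <- s) e i y.
have ma i : seq_measurable (a i) by exact: seq_measurable_prod.
have a0 i s : 0 <= a i s by apply: prodr_ge0.
pose g i s := gkl (a i s) (q s).
have mg i : seq_measurable (g i) by move=> n; apply: measurable_gkl; [exact: ma|exact: mq].
have g0 i s : 0 <= g i s.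
  by apply: gkl_ge0 => // [|qs0]; [exact: ltW|have := q0 s; rewrite qs0 ltxx].
have blk (f : 'I_k -> seq T -> R) : (forall i, seq_measurable (f i)) -> (forall i s, 0 <= f i s) ->
    (tint mu (size z) (fun x => (\prod_(i < k) f i (block z x i))%:E) =
     \prod_(i < k) tint mu (count_mem i z) (fun s => (f i s)%:E))%E.
  move=> mf f0; rewrite -(@tint_blocks _ _ _ _ mu z (fun i s => (f i s)%:E)).
  - by apply: eq_tint => x _; rewrite prodEFin.
  - by move=> i; exact: seq_measurable_EFin.
  - by move=> i s; rewrite lee_fin.
have mblk (f : 'I_k -> seq T -> R) : (forall i, seq_measurable (f i)) ->
    seq_measurable (fun x => (\prod_(i < k) f i (block z x i))%:E).
  move=> mf n; apply/measurable_EFinP; apply: measurable_prod => i _.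
  exact: (@seq_measurable_mask _ _ _ _ (f i) [seq j == i | j <- z] (mf i) n).
pose ab i j s := if j == i then q s else a j s.
pose ag i j s := if j == i then g j s else a j s.
have mab i j : seq_measurable (ab i j) by rewrite /ab; case: (j == i).
have mag i j : seq_measurable (ag i j) by rewrite /ag; case: (j == i).
have ab0 i j s : 0 <= ab i j s by rewrite /ab; case: (j == i) => //; exact: ltW.
have ag0 i j s : 0 <= ag i j s by rewrite /ag; case: (j == i).
have Iab i : tint mu (size z) (fun x => (\prod_(j < k) ab i j (block z x j))%:E) = 1%E.
  rewrite blk //; apply: big1 => j _; rewrite /ab; case: (j == i); [exact: q1|exact: e1].
have Iag i : tint mu (size z) (fun x => (\prod_(j < k) ag i j (block z x j))%:E) =
    tint mu (count_mem i z) (fun s => (g i s)%:E).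
  rewrite blk // (bigD1 i) //= /ag eqxx [X in (_ * X)%E]big1 ?mule1 // => j /negbTE ->.
  exact: e1.
have Ia : tint mu (size z) (fun x => (\prod_(j < k) a j (block z x j))%:E) = 1%E.
  by rewrite blk //; apply: big1 => j _; exact: e1.
have Ib : tint mu (size z) (fun x => (\prod_(j < k) q (block z x j))%:E) = 1%E.
  rewrite (blk (fun _ => q)) //; last by move=> _ s; exact: ltW.
  by apply: big1 => j _; exact: q1.
have mpe : seq_measurable (fun x => (path_emission z x)%:E) by exact: (mblk a).
have mpc : seq_measurable (fun x => (path_coding z x)%:E) by exact: (mblk (fun=> q)).
have pe0 x : 0 <= path_emission z x by apply: prodr_ge0 => i _; exact: a0.
have pc0 x : 0 < path_coding z x by apply: prodr_gt0.
have mG : seq_measurable (fun x => (gkl (path_emission z x) (path_coding z x))%:E).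
  by move=> n; apply/measurable_EFinP; apply: measurable_gkl; apply/measurable_EFinP; [exact: mpe|exact: mpc].
have G0 x : 0 <= gkl (path_emission z x) (path_coding z x).
  by apply: gkl_ge0 => // [|h]; [exact: ltW|have := pc0 x; rewrite h ltxx].
have key : tint mu (size z) (fun x => (gkl (path_emission z x) (path_coding z x))%:E +
      (\sum_(i < k) (\prod_(j < k) ab i j (block z x j))%:E + (path_emission z x)%:E))%E =
    tint mu (size z) (fun x => \sum_(i < k) (\prod_(j < k) ag i j (block z x j))%:E +
      (k%:R%:E * (path_emission z x)%:E + (path_coding z x)%:E))%E.
  apply: eq_tint => x _; rewrite !sumEFin -!EFinM -!EFinD; congr EFin.
  have := gkl_tensor (index_enum_uniq 'I_k) (fun i => a0 i (block z x i)) (fun i => q0 (block z x i)).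
  rewrite [X in X%:R](_ : _ = k); last first.
    by rewrite -[RHS]card_ord cardE enumT.
  by [].
have msum (f : 'I_k -> 'I_k -> seq T -> R) : (forall i j, seq_measurable (f i j)) ->
    seq_measurable (fun x => \sum_(i < k) (\prod_(j < k) f i j (block z x j))%:E)%E.
  by move=> mf n; apply: emeasurable_sum => i; exact: (mblk (f i)).
have mkp : seq_measurable (fun x => k%:R%:E * (path_emission z x)%:E)%E.
  by move=> n; apply: measurable_funeM; exact: mpe.
have mD (f1 f2 : seq T -> \bar R) : seq_measurable f1 -> seq_measurable f2 ->
    seq_measurable (fun x => f1 x + f2 x)%E.
  by move=> mf1 mf2 n; apply: emeasurable_funD; [exact: mf1|exact: mf2].
have sum0 (f : 'I_k -> 'I_k -> seq T -> R) : (forall i j s, 0 <= f i j s) ->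
    forall x, (0 <= \sum_(i < k) (\prod_(j < k) f i j (block z x j))%:E)%E.
  by move=> f0 x; apply: sume_ge0 => i _; rewrite lee_fin; apply: prodr_ge0.
have mSab := msum _ mab; have mSag := msum _ mag.
have Sab0 := sum0 _ ab0; have Sag0 := sum0 _ ag0.
have pe0E x : (0 <= (path_emission z x)%:E)%E by rewrite lee_fin.
have pc0E x : (0 <= (path_coding z x)%:E)%E by rewrite lee_fin ltW.
have kpe0 x : (0 <= k%:R%:E * (path_emission z x)%:E)%E by rewrite mule_ge0.
have s1 x := adde_ge0 (Sab0 x) (pe0E x); have s2 x := adde_ge0 (kpe0 x) (pc0E x).
have ms1 := mD _ _ mSab mpe; have ms2 := mD _ _ mkp mpc.
move: key; rewrite !tintD // !tint_sum //.
- rewrite (eq_bigr (fun _ => 1%:E)) // (eq_bigr _ (fun i _ => Iag i)).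
  rewrite tintZ // Ia Ib sumEFin sumr_const card_ord mule1.
  by move=> /(congr1 (fun t => t - (k%:R%:E + 1))%E); rewrite !addeK.
- by move=> i; exact: (mblk (ag i)).
- by move=> i x; rewrite lee_fin; apply: prodr_ge0 => j _; exact: ag0.
- by move=> i; exact: (mblk (ab i)).
- by move=> i x; rewrite lee_fin; apply: prodr_ge0 => j _; exact: ab0.
Qed.
End path_density.

Section jensen.
Context {R : realType}.
Implicit Types rho : R -> R.

Lemma concave_nonnegP rho t x y : concave_on_nonneg rho ->
  0 <= t -> t <= 1 -> 0 <= x -> 0 <= y ->
  t * rho x + (1 - t) * rho y <= rho (t * x + (1 - t) * y).
Proof.
move=> crho t0 t1 x0 y0.
have Dx : x \in (`[0, +oo[%classic : set R) by rewrite inE /= in_itv /= andbT.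
have Dy : y \in (`[0, +oo[%classic : set R) by rewrite inE /= in_itv /= andbT.
have := crho (Itv01 t0 t1) x y Dx Dy.
rewrite convRE /= !mulrN -opprD lerN2 => /le_trans; apply.
exact: lexx.
Qed.

Lemma concave_jensen rho k (x : 'I_k -> R) : concave_on_nonneg rho ->
  (0 < k)%N -> (forall i, 0 <= x i) ->
  \sum_(i < k) rho (x i) <= k%:R * rho ((\sum_(i < k) x i) / k%:R).
Proof.
move=> crho; case: k x => // k x _; elim: k x => [|k ih] x x0.
  by rewrite !big_ord1 divr1 mul1r.
rewrite big_ord_recr [in leRHS]big_ord_recr /=.
set S := \sum_(i < k.+1) x _.
have S0 : 0 <= S by apply: sumr_ge0.
have h1 := ih (fun i => x (widen_ord (leqnSn k.+1) i)) (fun i => x0 _).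
have t0 : 0 <= k.+1%:R / k.+2%:R :> R by rewrite divr_ge0.
have t1 : k.+1%:R / k.+2%:R <= 1 :> R by rewrite ler_pdivrMr // mul1r ler_nat.
have t'E : 1 - k.+1%:R / k.+2%:R = k.+2%:R^-1 :> R.
  by rewrite -[X in X - _](@divff _ k.+2%:R) // -mulrBl -natrB // subSnn mul1r.
have := concave_nonnegP crho t0 t1 (divr_ge0 S0 (ler0n R k.+1)) (x0 ord_max).
rewrite t'E [X in _ <= rho X](_ : _ = (S + x ord_max) / k.+2%:R); last first.
  by rewrite mulrDl [_^-1 * x _]mulrC [_ * (S / _)]mulrC -mulrA mulKf.
rewrite -(ler_pM2l (ltr0Sn R k.+1)); apply: le_trans.
rewrite mulrDr mulrA [_ * (k.+1%:R / _)]mulrCA divff // mulr1 mulVKf //.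
by rewrite lerD2r.
Qed.

(** By concavity, the even split of the letters among the [k] blocks is the most
    expensive one. *)
Lemma jensen_path_cost rho k c (z : seq 'I_k) : concave_on_nonneg rho -> (0 < k)%N ->
  \sum_(i < k) (rho (count_mem i z)%:R + c) <= k%:R * rho ((size z)%:R / k%:R) + k%:R * c.
Proof.
move=> crho k0; rewrite big_split /= sumr_const card_ord -(mulr_natl c) lerD2r.
have -> : (size z)%:R = \sum_(i < k) (count_mem i z)%:R :> R.
  rewrite -natr_sum; congr (_%:R); elim: z => [|j z ih] /=; first by rewrite big1.
  rewrite big_split /= -ih (bigD1 j) //= eqxx big1 ?addn0 // => i ij.
  by rewrite eq_sym (negbTE ij).
by rewrite concave_jensen.
Qed.
End jensen.

(** * The forward recursion of a hidden Markov model *)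

Lemma big_rcons_tuple (R : nmodType) (I : finType) n (F : n.+1.-tuple I -> R) :
  \sum_z F z = \sum_(z : n.-tuple I) \sum_(i : I) F (rcons_tuple z i).
Proof.
rewrite pair_big /=.
pose h (p : n.-tuple I * I) : n.+1.-tuple I := rcons_tuple p.1 p.2.
have hinj : injective h.
  move=> [z i] [z' i'] /(congr1 val) /= /rcons_inj [zz ->].
  by congr pair; exact/val_inj.
have hbij : bijective h.
  by apply: inj_card_bij => //; rewrite card_prod !card_tuple expnSr.
by rewrite (reindex h); [apply: eq_bigr => -[]|exact: onW_bij].
Qed.

Section forward.
Context d (T : measurableType d) (R : realType) (k : nat).
Variables (M : 'M[R]_k) (e : 'I_k -> T -> R).
Implicit Types (v : 'rV[R]_k) (x u : seq T) (z : seq 'I_k).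

(** The unnormalized filter: entry [j] of [fwd v x] is the joint density of the
    observations [x] and of the next hidden state being [j], when the first
    hidden state has law [v]. *)
Definition fwd_step v y : 'rV[R]_k := \row_j \sum_i v ord0 i * e i y * M i j.
Definition fwd v x := foldl fwd_step v x.
Definition plik v x := \sum_j fwd v x ord0 j.

Lemma fwd_rcons v x y : fwd v (rcons x y) = fwd_step (fwd v x) y.
Proof. by rewrite /fwd foldl_rcons. Qed.

Lemma fwd_cat v u x : fwd v (u ++ x) = fwd (fwd v u) x.
Proof. by rewrite /fwd foldl_cat. Qed.

Lemma fwd_linear v x : fwd v x = \sum_a v ord0 a *: fwd (delta_mx ord0 a) x.
Proof.
elim/last_ind: x => [|x y ih]; first by rewrite /= -row_sum_delta.
rewrite fwd_rcons ih; apply/rowP => j; rewrite !mxE summxE.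
under eq_bigr do rewrite summxE !mulr_suml.
rewrite exchange_big; apply: eq_bigr => a _ /=; rewrite fwd_rcons !mxE mulr_sumr.
by apply: eq_bigr => i _; rewrite !mxE !mulrA.
Qed.

Lemma plik_linear v x : plik v x = \sum_a v ord0 a * plik (delta_mx ord0 a) x.
Proof.
rewrite /plik fwd_linear; under eq_bigr do rewrite summxE.
rewrite exchange_big; apply: eq_bigr => a _; rewrite mulr_sumr.
by apply: eq_bigr => j _; rewrite !mxE.
Qed.

Lemma plik_cat v u x :
  plik v (u ++ x) = \sum_a fwd v u ord0 a * plik (delta_mx ord0 a) x.
Proof. by rewrite /plik fwd_cat -/(plik _ _) plik_linear. Qed.

Definition path_weight v z : R :=
  if z is i :: z' then v ord0 i * \prod_(p <- pairmap pair i z') M p.1 p.2 else 1.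

Lemma path_weight_rcons v z i j :
  path_weight v (rcons (rcons z i) j) = path_weight v (rcons z i) * M i j.
Proof.
case: z => [|i0 z] /=; first by rewrite big_nil big_seq1 mulr1.
by rewrite -cats1 pairmap_cat /= last_rcons cats1 big_rcons /= mulrA.
Qed.

Lemma path_emission_rcons z x i y : size x = size z ->
  path_emission e (rcons z i) (rcons x y) = path_emission e z x * e i y.
Proof.
move=> sx; rewrite /path_emission (bigD1 i) //= [in RHS](bigD1 i) //=.
rewrite block_rcons // eqxx big_rcons /= mulrAC; congr (_ * _ * _).
by apply: eq_bigr => j ji; rewrite block_rcons // (negbTE ji).
Qed.

(** Unfolding the recursion sums over all hidden paths. *)
Lemma fwd_paths v x n j : size x = n ->
  fwd v x ord0 j = \sum_(z : n.-tuple 'I_k) path_weight v (rcons z j) * path_emission e z x.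
Proof.
elim: n x j => [|n ih] x j.
  move=> /eqP; rewrite size_eq0 => /eqP ->.
  rewrite (big_pred1 [tuple]) => [|z]; last by apply/esym/eqP; exact: tuple0.
  rewrite /= big_nil mulr1 /path_emission big1 ?mulr1 // => i _.
  by rewrite big_nil.
case/lastP: x => // x y; rewrite size_rcons => -[sx].
rewrite fwd_rcons mxE big_rcons_tuple exchange_big; apply: eq_bigr => i _.
rewrite ih // !mulr_suml; apply: eq_bigr => z _.
rewrite path_weight_rcons path_emission_rcons ?size_tuple //; ring.
Qed.

Hypothesis M1 : forall i, \sum_j M i j = 1.

Lemma plik_rcons v x y : plik v (rcons x y) = \sum_i fwd v x ord0 i * e i y.
Proof.
rewrite /plik; under eq_bigr do rewrite fwd_rcons mxE.
by rewrite exchange_big; apply: eq_bigr => i _; rewrite -mulr_sumr M1 mulr1.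
Qed.

Lemma plik_paths v x n : size x = n.+1 ->
  plik v x = \sum_(z : n.+1.-tuple 'I_k) path_weight v z * path_emission e z x.
Proof.
case/lastP: x => // x y; rewrite size_rcons => -[sx].
rewrite plik_rcons big_rcons_tuple exchange_big; apply: eq_bigr => i _.
rewrite (fwd_paths _ _ sx) mulr_suml; apply: eq_bigr => z _.
by rewrite path_emission_rcons ?size_tuple // mulrA.
Qed.

Lemma sum_path_weight v n :
  \sum_(z : n.+1.-tuple 'I_k) path_weight v z = \sum_i v ord0 i.
Proof.
elim: n => [|n ih].
  rewrite big_rcons_tuple (big_pred1 [tuple]) => [|z]; last by apply/esym/eqP; exact: tuple0.
  by apply: eq_bigr => i _; rewrite /= big_nil mulr1.
rewrite -ih big_rcons_tuple [RHS]big_rcons_tuple big_rcons_tuple.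
apply: eq_bigr => z _; apply: eq_bigr => j _ /=.
by under eq_bigr do rewrite path_weight_rcons; rewrite -mulr_sumr M1 mulr1.
Qed.

Hypotheses (M0 : forall i j, 0 <= M i j) (e0 : forall i y, 0 <= e i y).

Lemma path_weight_ge0 v z : (forall i, 0 <= v ord0 i) -> 0 <= path_weight v z.
Proof.
move=> v0; case: z => //= i z; rewrite mulr_ge0 //.
by apply: prodr_ge0.
Qed.

Lemma fwd_ge0 v x j : (forall i, 0 <= v ord0 i) -> 0 <= fwd v x ord0 j.
Proof.
move=> v0; elim/last_ind: x j => [|x y ih] j //.
by rewrite fwd_rcons mxE; apply: sumr_ge0 => i _; rewrite !mulr_ge0.
Qed.

Lemma plik_ge0 v x : (forall i, 0 <= v ord0 i) -> 0 <= plik v x.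
Proof. by move=> v0; apply: sumr_ge0 => j _; exact: fwd_ge0. Qed.

Lemma plik_rcons_eq0 v x y : (forall i, 0 <= v ord0 i) ->
  plik v x = 0 -> plik v (rcons x y) = 0.
Proof.
move=> v0 /eqP; rewrite psumr_eq0 => [|j _]; last exact: fwd_ge0.
move=> /allP h; rewrite plik_rcons big1 // => i _.
by have := h i (mem_index_enum i) => /= /eqP ->; rewrite mul0r.
Qed.

Hypotheses (me : forall i, measurable_fun [set: T] (e i)).

Lemma seq_measurable_path_emission z : seq_measurable (path_emission e z).
Proof.
move=> n; apply: measurable_prod => i _.
exact: (@seq_measurable_mask _ _ _ _ (fun s => \prod_(y <- s) e i y)
  [seq j == i | j <- z] (seq_measurable_prod (me i)) n).
Qed.

Lemma seq_measurable_fwd v j : seq_measurable (fun x => fwd v x ord0 j).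
Proof.
move=> n; rewrite (_ : (fun w => _) = (fun w : n.-tuple T =>
    \sum_(z : n.-tuple 'I_k) path_weight v (rcons z j) * path_emission e z w)).
  apply: measurable_sum => z; apply: measurable_funM => //.
  exact: seq_measurable_path_emission.
by apply/funext => w; rewrite (fwd_paths _ _ (size_tuple w)).
Qed.

Lemma seq_measurable_plik v : seq_measurable (plik v).
Proof.
move=> n; apply: (@measurable_sum _ _ _ _ _ _ (fun j (w : n.-tuple T) => fwd v w ord0 j)) => j.
by have := @seq_measurable_fwd v j n; exact.
Qed.

Variable mu : probability T R.
Hypothesis e1 : forall i, (\int[mu]_y (e i y)%:E = 1)%E.

Lemma integral_plik v x : (forall i, 0 <= v ord0 i) ->
  (\int[mu]_y (plik v (rcons x y))%:E = (plik v x)%:E)%E.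
Proof.
move=> v0; under eq_integral do rewrite plik_rcons -sumEFin.
rewrite ge0_integral_sum //; last 2 first.
- by move=> i; apply/measurable_EFinP; exact: measurable_funM.
- by move=> i y _; rewrite lee_fin mulr_ge0 // fwd_ge0.
rewrite -sumEFin; apply: eq_bigr => i _.
under eq_integral do rewrite EFinM.
rewrite ge0_integralZl //; first by rewrite e1 mule1.
- exact/measurable_EFinP.
- by move=> y _; rewrite lee_fin.
- by rewrite lee_fin fwd_ge0.
Qed.

(** Integrating the observations out leaves the evolution of the hidden chain;
    in the stationary regime the law of the hidden state does not move. *)
Lemma tint_fwd v n j : (forall i, 0 <= v ord0 i) -> v *m M = v ->
  tint mu n (fun x => (fwd v x ord0 j)%:E) = (v ord0 j)%:E.
Proof.
move=> v0 vM; have mE i : seq_measurable (fun x => (fwd v x ord0 i)%:E).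
  by apply: seq_measurable_EFin; exact: seq_measurable_fwd.
have fE0 i x : (0 <= (fwd v x ord0 i)%:E)%E by rewrite lee_fin fwd_ge0.
elim: n j => [|n ih] j; first by rewrite tint0.
rewrite tintS //.
transitivity (tint mu n (fun x => \sum_i (M i j)%:E * (fwd v x ord0 i)%:E)%E).
  apply: eq_tint => x _.
  transitivity (\int[mu]_y (\sum_i (fwd v x ord0 i * M i j)%:E * (e i y)%:E))%E.
    apply: eq_integral => y _; rewrite fwd_rcons mxE -sumEFin.
    by apply: eq_bigr => i _; rewrite -EFinM mulrAC.
  rewrite ge0_integral_sum //; last 2 first.
  - by move=> i; apply: measurable_funeM; exact/measurable_EFinP.
  - by move=> i y _; rewrite mule_ge0 // lee_fin // mulr_ge0 // fwd_ge0.
  apply: eq_bigr => i _; rewrite ge0_integralZl //.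
  - by rewrite e1 mule1 -EFinM mulrC.
  - exact/measurable_EFinP.
  - by move=> y _; rewrite lee_fin.
  - by rewrite lee_fin mulr_ge0 // fwd_ge0.
rewrite tint_sum; last 2 first.
- by move=> i m; apply: measurable_funeM; exact: mE.
- by move=> i x; rewrite mule_ge0 // lee_fin.
have <- : (v *m M) ord0 j = v ord0 j by rewrite vM.
rewrite mxE -sumEFin; apply: eq_bigr => i _.
by rewrite tintZ // ih -EFinM mulrC.
Qed.

End forward.

(** * Types of hidden paths and the mixture code *)

Section type_weights.
Local Close Scope classical_set_scope.
Context {R : realType} (Z Th : finType) (tau : Z -> Th).

(** Uniform over the types, then uniform within a type. *)
Definition type_weight (z : Z) : R :=
  (#|tau @: [set: Z]|%:R * #|[set z' | tau z' == tau z]|%:R)^-1.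

Lemma card_type_gt0 z : 0 < #|[set z' | tau z' == tau z]|%:R :> R.
Proof. by rewrite ltr0n card_gt0; apply/set0Pn; exists z; rewrite inE. Qed.

Lemma card_types_gt0 (z : Z) : 0 < #|tau @: [set: Z]|%:R :> R.
Proof. by rewrite ltr0n card_gt0; apply/set0Pn; exists (tau z); exact: imset_f. Qed.

Lemma type_weight_gt0 z : 0 < type_weight z.
Proof. by rewrite invr_gt0 mulr_gt0 ?card_types_gt0 ?card_type_gt0. Qed.

Lemma sum_type_weight (z0 : Z) : \sum_z type_weight z = 1.
Proof.
rewrite (partition_big tau [in tau @: [set: Z]]) /=; last by move=> z _; exact: imset_f.
transitivity (\sum_(t in tau @: [set: Z]) (#|tau @: [set: Z]|%:R^-1 : R)).
  apply: eq_bigr => t /imsetP[z _ ->].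
  rewrite (eq_bigr (fun=> type_weight z)); last first.
    by move=> z' /eqP tz'; rewrite /type_weight; congr (_ * _%:R)^-1; apply: eq_card => y; rewrite !inE tz'.
  rewrite sumr_const -[LHS]mulr_natr /type_weight invfM -mulrA.
  rewrite [X in _ * X](_ : _ = 1) ?mulr1 //.
  rewrite (_ : #|_| = #|[set z' | tau z' == tau z]|); last by apply: eq_card => y; rewrite !inE.
  by rewrite mulVf // gt_eqF // card_type_gt0.
by rewrite sumr_const -[LHS]mulr_natr mulVf // gt_eqF // (card_types_gt0 z0).
Qed.

(** A law that is constant on types gives each point of a type at most the
    inverse of the size of its type. *)
Lemma le_type_weight (p : Z -> R) z : (forall y, 0 <= p y) -> \sum_y p y = 1 ->
  (forall y, tau y = tau z -> p y = p z) ->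
  p z <= #|tau @: [set: Z]|%:R * type_weight z.
Proof.
move=> p0 p1 ptau.
rewrite /type_weight invfM mulrA divff ?gt_eqF ?card_types_gt0 // mul1r.
rewrite -[leRHS]mul1r ler_pdivlMr ?card_type_gt0 // -[leRHS]p1.
rewrite [leLHS]mulr_natr -sumr_const [leRHS](bigID (fun y => tau y == tau z)) /=.
rewrite -[leLHS]addr0 lerD ?sumr_ge0 //.
rewrite le_eqVlt; apply/orP; left; apply/eqP.
rewrite (eq_bigl (fun y => tau y == tau z)) => [|y]; last by rewrite inE.
by apply: eq_bigr => y /eqP /ptau.
Qed.

End type_weights.

Section type_count.
Local Close Scope classical_set_scope.
Context {R : realType}.

(** Weighting each function by [t] to the power of its sum turns the count into
    a product of geometric series. *)
Lemma card_sum_ffun_le (D : finType) n (t : R) : 0 < t -> t < 1 ->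
  #|[set N : {ffun D -> 'I_n.+1} | (\sum_p N p == n)%N]|%:R <= t ^- n * (1 - t) ^- #|D|.
Proof.
move=> t0 t1; have t1' : 0 < 1 - t by rewrite subr_gt0.
rewrite mulrC ler_pdivlMr ?exprn_gt0 //.
apply: (@le_trans _ _ (\sum_(N : {ffun D -> 'I_n.+1}) \prod_p t ^+ (N p))).
  rewrite mulr_natl -sumr_const [leRHS](bigID (fun N : {ffun D -> 'I_n.+1} => (\sum_p N p == n)%N)) /=.
  rewrite -[leLHS]addr0 lerD //; last first.
    by apply: sumr_ge0 => N _; apply: prodr_ge0 => p _; rewrite exprn_ge0 // ltW.
  rewrite le_eqVlt; apply/orP; left; apply/eqP.
  rewrite (eq_bigl (fun N : {ffun D -> 'I_n.+1} => (\sum_p N p == n)%N)) => [|N]; last by rewrite inE.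
  by apply: eq_bigr => N /eqP sN; rewrite -expr_sum; congr (t ^+ _).
rewrite -(bigA_distr_bigA (fun (p : D) (j : 'I_n.+1) => t ^+ j)) /=.
rewrite prodr_const -exprVn lerXn2r ?nnegrE ?invr_ge0 ?(ltW t1') //.
  by apply: sumr_ge0 => j _; rewrite exprn_ge0 // ltW.
rewrite -[leRHS]mul1r ler_pdivlMr //.
have := subrX1 t n.+1 => h.
by rewrite mulrC -opprB mulNr -h opprB gerBl exprn_ge0 ?(ltW t0).
Qed.

Lemma ln_1Dx_le (x : R) : 0 <= x -> ln (1 + x) <= x.
Proof. by move=> x0; apply: le_ln1Dx; lra. Qed.

Lemma ln_card_sum_ffun_le (D : finType) n : (0 < n)%N -> (0 < #|D|)%N ->
  ln #|[set N : {ffun D -> 'I_n.+1} | (\sum_p N p == n)%N]|%:R <=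
  #|D|%:R + #|D|%:R * ln (1 + n%:R / #|D|%:R) :> R.
Proof.
move=> n0 D0; set m := #|_|.
have nR : 0 < n%:R :> R by rewrite ltr0n.
have DR : 0 < #|D|%:R :> R by rewrite ltr0n.
(* With this [t], the factor [t ^- n] is at most [expR #|D|%:R]. *)
pose t : R := n%:R / (n%:R + #|D|%:R).
have t0 : 0 < t by rewrite divr_gt0 // addr_gt0.
have t1 : t < 1 by rewrite ltr_pdivrMr ?addr_gt0 // mul1r ltrDl.
have E1 : t^-1 = 1 + #|D|%:R / n%:R by rewrite invf_div; field; rewrite gt_eqF.
have E2 : (1 - t)^-1 = 1 + n%:R / #|D|%:R.
  by rewrite /t; field; rewrite !gt_eqF //= addr_gt0.
have := card_sum_ffun_le D n t0 t1; rewrite -/m -!exprVn E1 E2.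
have [->|m0] := posnP m.
  by rewrite ln0 // => _; rewrite addr_ge0 // mulr_ge0 ?ln_ge0 // ?lerDl ?divr_ge0 ?ltW.
have p1 : 0 < 1 + #|D|%:R / n%:R :> R by rewrite addr_gt0 // divr_gt0.
have p2 : 0 < 1 + n%:R / #|D|%:R :> R by rewrite addr_gt0 // divr_gt0.
move=> hm.
have : ln m%:R <= ln ((1 + #|D|%:R / n%:R) ^+ n * (1 + n%:R / #|D|%:R) ^+ #|D|) :> R.
  by rewrite ler_ln ?posrE ?ltr0n // mulr_gt0 ?exprn_gt0.
rewrite [X in _ <= X -> _]lnM ?posrE ?exprn_gt0 // !lnXn // => /le_trans; apply.
rewrite -[ln (1 + n%:R / _) *+ _]mulr_natl lerD2r -[leLHS]mulr_natl.
by rewrite mulrC -ler_pdivlMr // ln_1Dx_le // divr_ge0 // ltW.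
Qed.
End type_count.

Section markov_types.
Local Close Scope classical_set_scope.
Context {R : realType} (k : nat).
Implicit Types (z : seq 'I_k).

Definition transitions (i : 'I_k) z := pairmap pair i z.

Lemma prod_count (D : finType) (F : D -> R) (s : seq D) :
  \prod_(p <- s) F p = \prod_p F p ^+ count_mem p s.
Proof.
elim: s => [|p0 s ih]; first by rewrite big_nil big1.
rewrite big_cons ih (bigD1 p0) //= [RHS](bigD1 p0) //= eqxx exprS -mulrA.
by congr (_ * (_ * _)); apply: eq_bigr => p /negbTE pp0; rewrite eq_sym pp0.
Qed.

(** The probability of a path depends only on its first state and on the number
    of transitions of each kind; see [path_weight_type]. *)
Definition markov_type n (z : n.+1.-tuple 'I_k) : 'I_k * {ffun 'I_k * 'I_k -> 'I_n.+1} :=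
  (thead z, [ffun p => inord (count_mem p (transitions (thead z) (behead z)))]).

Lemma count_transitions n (z : n.+1.-tuple 'I_k) p :
  (markov_type z).2 p = count_mem p (transitions (thead z) (behead z)) :> nat.
Proof.
rewrite ffunE inordK // ltnS (leq_trans (count_size _ _)) //.
by rewrite size_pairmap size_tuple.
Qed.

Lemma path_weight_type (M : 'M[R]_k) v n (y z : n.+1.-tuple 'I_k) :
  markov_type y = markov_type z -> path_weight M v y = path_weight M v z.
Proof.
have E (w : n.+1.-tuple 'I_k) : path_weight M v w =
    v ord0 (markov_type w).1 * \prod_p M p.1 p.2 ^+ (markov_type w).2 p.
  under eq_bigr do rewrite count_transitions.
  rewrite -(prod_count (fun p => M p.1 p.2)).
  by case/tupleP: w => i w; rewrite /= /transitions theadE.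
by rewrite !E => ->.
Qed.

Lemma ln_card_markov_types n : (0 < n)%N -> (0 < k)%N ->
  ln #|@markov_type n @: [set: n.+1.-tuple 'I_k]|%:R <=
  ln k%:R + (k%:R ^+ 2 + k%:R ^+ 2 * ln (1 + n%:R / k%:R ^+ 2)) :> R.
Proof.
move=> n0 k0; set B := _ @: _.
pose A := [set N : {ffun 'I_k * 'I_k -> 'I_n.+1} | (\sum_p N p == n)%N].
have BA : (#|B| <= k * #|A|)%N.
  have -> : (k * #|A| = #|finset.setX [set: 'I_k] A|)%N by rewrite cardsX cardsT card_ord.
  apply/subset_leq_card/fintype.subsetP => _ /imsetP[z _ ->]; rewrite !inE /=.
  under eq_bigr do rewrite count_transitions.
  apply/eqP; transitivity (size (transitions (thead z) (behead z))).
    elim: (transitions _ _) => [|p0 s ih] /=; first by rewrite big1.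
    rewrite big_split /= ih (bigD1 p0) //= eqxx big1 ?addn0 // => p pp0.
    by rewrite eq_sym (negbTE pp0).
  by rewrite size_pairmap size_tuple.
have B0 : (0 < #|B|)%N.
  rewrite card_gt0; apply/set0Pn.
  by exists (markov_type [tuple of nseq n.+1 (Ordinal k0)]); exact: imset_f.
have A0 : (0 < #|A|)%N by move: (leq_trans B0 BA); rewrite muln_gt0 => /andP[].
have kR : 0 < k%:R :> R by rewrite ltr0n.
have AR : 0 < #|A|%:R :> R by rewrite ltr0n.
apply: (@le_trans _ _ (ln (k%:R * #|A|%:R))).
  by rewrite ler_ln ?posrE ?mulr_gt0 ?ltr0n // -natrM ler_nat.
rewrite lnM ?posrE // lerD2l.
have := @ln_card_sum_ffun_le R ('I_k * 'I_k)%type n n0.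
by rewrite card_prod card_ord muln_gt0 k0 natrM -expr2; apply.
Qed.
End markov_types.

Section path_mixture.
Local Close Scope classical_set_scope.
Context d (T : measurableType d) (R : realType) (k n : nat).
Variables (mu : probability T R) (M : 'M[R]_k) (e : 'I_k -> T -> R) (q : seq T -> R).

(** The code for the observations: a mixture over hidden paths of the codes that
    treat the blocks cut out by the path separately. *)
Definition path_mixture (x : seq T) : R :=
  \sum_(z : n.+1.-tuple 'I_k) type_weight (@markov_type k n) z * path_coding q z x.

Hypotheses (M1 : forall i, \sum_j M i j = 1) (M0 : forall i j, 0 <= M i j).
Hypotheses (me : forall i, measurable_fun setT (e i)) (e0 : forall i y, 0 <= e i y).
Hypotheses (e1 : forall i m, tint mu m (fun s => (\prod_(y <- s) e i y)%:E) = 1%E).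
Hypotheses (mq : seq_measurable q) (q0 : forall s, 2^-1 <= q s).
Hypothesis (q1 : forall m, tint mu m (fun s => (q s)%:E) = 1%E).

Lemma path_coding_gt0 z x : 0 < path_coding q (z : seq 'I_k) x.
Proof. by apply: prodr_gt0 => i _; rewrite (lt_le_trans _ (q0 _)). Qed.

Lemma seq_measurable_path_coding z : seq_measurable (path_coding q (z : seq 'I_k)).
Proof.
move=> m; apply: measurable_prod => i _.
exact: (@seq_measurable_mask _ _ _ _ q [seq j == i | j <- z] mq m).
Qed.

Lemma seq_measurable_path_mixture : seq_measurable path_mixture.
Proof.
move=> m; apply: measurable_sum => z; apply: measurable_funM => //.
exact: (@seq_measurable_path_coding z m).
Qed.

Lemma tint_path_coding z : tint mu (size z) (fun x => (path_coding q (z : seq 'I_k) x)%:E) = 1%E.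
Proof.
rewrite -(@eq_tint _ _ _ _ _ (fun x => \prod_(i < k) (q (block z x i))%:E)%E); last first.
  by move=> x _; rewrite prodEFin.
rewrite (@tint_blocks _ _ _ _ mu z (fun _ s => (q s)%:E)).
- by apply: big1 => i _; exact: q1.
- by move=> _; exact: seq_measurable_EFin.
- by move=> _ s; rewrite lee_fin (le_trans _ (q0 s)).
Qed.

Hypothesis k0 : (0 < k)%N.

Lemma path_mixture_ge x : 2^-1 ^+ k <= path_mixture x.
Proof.
pose z0 : n.+1.-tuple 'I_k := [tuple of nseq n.+1 (Ordinal k0)].
have -> : 2^-1 ^+ k = \sum_z type_weight (@markov_type k n) z * 2^-1 ^+ k :> R.
  by rewrite -mulr_suml (sum_type_weight _ z0) mul1r.
apply: ler_sum => z _; rewrite ler_wpM2l ?(ltW (type_weight_gt0 _ z)) //.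
rewrite -[X in _ ^+ X]card_ord -prodr_const; apply: ler_prod => i _.
by rewrite q0 andbT invr_ge0.
Qed.

Lemma tint_path_mixture : tint mu n.+1 (fun x => (path_mixture x)%:E) = 1%E.
Proof.
have pc0 z x : 0 <= path_coding q (z : seq 'I_k) x by rewrite ltW // path_coding_gt0.
pose z0 : n.+1.-tuple 'I_k := [tuple of nseq n.+1 (Ordinal k0)].
rewrite -(@eq_tint _ _ _ _ _ (fun x => \sum_(z : n.+1.-tuple 'I_k)
    (type_weight (@markov_type k n) z)%:E * (path_coding q z x)%:E)%E); last first.
  by move=> x _; rewrite -sumEFin.
rewrite tint_sum; last 2 first.
- by move=> z m; apply: measurable_funeM; apply: (seq_measurable_EFin (seq_measurable_path_coding z)).
- by move=> z x; rewrite mule_ge0 // lee_fin // ltW // type_weight_gt0.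
transitivity (\sum_(z : n.+1.-tuple 'I_k) (type_weight (@markov_type k n) z : R)%:E)%E.
  apply: eq_bigr => z _; rewrite tintZ.
  - by have := tint_path_coding z; rewrite size_tuple => ->; rewrite mule1.
  - exact: (seq_measurable_EFin (seq_measurable_path_coding z)).
  - by move=> x; rewrite lee_fin.
  - exact/ltW/type_weight_gt0.
by rewrite sumEFin (sum_type_weight _ z0).
Qed.

Lemma tint_path_emission z :
  tint mu (size z) (fun x => (path_emission e (z : seq 'I_k) x)%:E) = 1%E.
Proof.
rewrite -(@eq_tint _ _ _ _ _ (fun x => \prod_(i < k) (\prod_(y <- block z x i) e i y)%:E)%E); last first.
  by move=> x _; rewrite prodEFin.
rewrite (@tint_blocks _ _ _ _ mu z (fun i s => (\prod_(y <- s) e i y)%:E)).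
- by apply: big1 => i _; exact: e1.
- by move=> i; apply: seq_measurable_EFin; exact: seq_measurable_prod.
- by move=> i s; rewrite lee_fin prodr_ge0.
Qed.

Lemma integrable_tint1 m (f : seq T -> R) : seq_measurable f -> (forall s, 0 <= f s) ->
  tint mu m (fun s => (f s)%:E) = 1%E ->
  (tpow mu m).-integrable setT (fun w => (f (tval w))%:E).
Proof.
move=> mf f0 f1; apply/integrableP; split; first by apply/measurable_EFinP; exact: mf.
under eq_integral do rewrite /= ger0_norm //.
by rewrite -/(tint _ _ (fun s => (f s)%:E)) f1 ltry.
Qed.

(** For a single path, the divergence between joint densities is the divergence
    between the weights plus that between the conditional densities. *)
Lemma tint_gkl_scaled (z : n.+1.-tuple 'I_k) (P w : R) : 0 <= P -> 0 < w ->
  (tint mu n.+1 (fun x => (gkl (P * path_emission e z x) (w * path_coding q z x))%:E) =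
   P%:E * tint mu n.+1 (fun x => (gkl (path_emission e z x) (path_coding q z x))%:E)
   + (P * ln (P / w) + (w - P))%:E)%E.
Proof.
move=> P0 w0.
have pe0 x : 0 <= path_emission e z x.
  by apply: prodr_ge0 => i _; apply: prodr_ge0.
have pc0 := path_coding_gt0 z.
have mpe := seq_measurable_path_emission me z.
have mpc := seq_measurable_path_coding z.
have Ipe : tint mu n.+1 (fun x => (path_emission e z x)%:E) = 1%E.
  by have := tint_path_emission z; rewrite size_tuple.
have Ipc : tint mu n.+1 (fun x => (path_coding q z x)%:E) = 1%E.
  by have := tint_path_coding z; rewrite size_tuple.
have ipe := integrable_tint1 mpe pe0 Ipe.
have ipc := integrable_tint1 mpc (fun x => ltW (pc0 x)) Ipc.
have g0 x : 0 <= gkl (path_emission e z x) (path_coding q z x).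
  by apply: gkl_ge0 => // [|h]; [exact: ltW|have := pc0 x; rewrite h ltxx].
have mg : seq_measurable (fun x => gkl (path_emission e z x) (path_coding q z x)).
  by move=> m; apply: measurable_gkl; [exact: mpe|exact: mpc].
pose c1 := P * ln (P / w); pose c2 := w - P.
pose r (x : n.+1.-tuple T) := c1 * path_emission e z x + c2 * path_coding q z x.
transitivity (\int[tpow mu n.+1]_x
   (P%:E * (gkl (path_emission e z x) (path_coding q z x))%:E + (r x)%:E))%E.
  apply: eq_integral => x _; rewrite -EFinM -EFinD; congr EFin.
  rewrite (@gkl_chain _ P) //.
  - by rewrite -gklM // /r /c1 /c2; ring.
  - by rewrite mulr_ge0.
  - by move=> ->; rewrite mul0r.
have ir : (tpow mu n.+1).-integrable setT (EFin \o r).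
  rewrite (_ : _ \o _ = (fun x : n.+1.-tuple T => c1%:E * (path_emission e z x)%:E + c2%:E * (path_coding q z x)%:E))%E.
    by apply: integrableD => //; exact: integrableZl.
  by apply/funext => x; rewrite /r /= -!EFinM -EFinD.
rewrite integralD_ge0_integrable //; last 2 first.
- by apply: measurable_funeM; exact: (seq_measurable_EFin mg).
- by move=> x; rewrite mule_ge0 // lee_fin.
rewrite ge0_integralZl //; last 2 first.
- exact: (seq_measurable_EFin mg).
- by move=> x _; rewrite lee_fin.
congr (_ + _)%E; under eq_integral do rewrite EFinD !EFinM.
rewrite integralD //; [|exact: integrableZl..].
rewrite !integralZl // -/(tint _ _ (fun x => (path_emission e z x)%:E)) Ipe.
by rewrite -/(tint _ _ (fun x => (path_coding q z x)%:E)) Ipc !mule1.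
Qed.

(** Redundancy of the mixture: the hidden path is coded at the price of its
    type, the observations at the price of the blocks that the path cuts out. *)
Lemma tint_gkl_mixture (v : 'rV[R]_k) (G : R) :
  (forall i, 0 <= v ord0 i) -> \sum_i v ord0 i = 1 -> 0 <= G ->
  (forall z : n.+1.-tuple 'I_k,
    tint mu n.+1 (fun x => (gkl (path_emission e z x) (path_coding q z x))%:E) <= G%:E)%E ->
  (tint mu n.+1 (fun x => (gkl (plik M e v x) (path_mixture x))%:E) <=
   (ln #|@markov_type k n @: [set: n.+1.-tuple 'I_k]|%:R + G)%:E)%E.
Proof.
move=> v0 v1 G0 hG.
pose m : R := #|@markov_type k n @: [set: n.+1.-tuple 'I_k]|%:R.
pose P (z : n.+1.-tuple 'I_k) := path_weight M v z.
pose w (z : n.+1.-tuple 'I_k) : R := type_weight (@markov_type k n) z.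
pose z0 : n.+1.-tuple 'I_k := [tuple of nseq n.+1 (Ordinal k0)].
have P0 z : 0 <= P z by exact: path_weight_ge0.
have P1 : \sum_z P z = 1 by rewrite -[RHS]v1; exact: sum_path_weight.
have w0 z : 0 < w z by exact: type_weight_gt0.
have w1 : \sum_z w z = 1 by exact: (sum_type_weight _ z0).
have m0 : 0 < m by exact: (card_types_gt0 _ z0).
have pc0 z := @path_coding_gt0 z.
have pe0 (z : seq 'I_k) x : 0 <= path_emission e z x.
  by apply: prodr_ge0 => i _; apply: prodr_ge0.
have zero z x : w z * path_coding q (tval z) x = 0 -> P z * path_emission e (tval z) x = 0.
  by move=> /eqP; rewrite mulf_eq0 !gt_eqF.
have g0 z x : 0 <= gkl (P z * path_emission e (tval z) x) (w z * path_coding q (tval z) x).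
  by apply: gkl_ge0; [exact: mulr_ge0|rewrite ltW ?mulr_gt0|exact: zero].
have mg (z : n.+1.-tuple 'I_k) :
    seq_measurable (fun x => (gkl (P z * path_emission e (tval z) x) (w z * path_coding q (tval z) x))%:E).
  apply: seq_measurable_EFin => j; apply: measurable_gkl; apply: measurable_funM => //.
  - by have := seq_measurable_path_emission me z (n := j); exact.
  - by have := @seq_measurable_path_coding z j; exact.
apply: (@le_trans _ _ (tint mu n.+1 (fun x => \sum_(z : n.+1.-tuple 'I_k)
    (gkl (P z * path_emission e (tval z) x) (w z * path_coding q (tval z) x))%:E)%E)).
  apply: le_tint => [| |x|x sx].
  - apply: seq_measurable_EFin => j; apply: measurable_gkl.
      exact: (seq_measurable_plik M me v).
    exact: seq_measurable_path_mixture.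
  - by move=> j; apply: emeasurable_sum => z; exact: mg.
  - rewrite lee_fin gkl_ge0 ?plik_ge0 //.
      by rewrite (le_trans _ (path_mixture_ge x)) // exprn_ge0 // invr_ge0.
    move=> h; have := path_mixture_ge x.
    by rewrite h leNgt exprn_gt0 // invr_gt0.
  - rewrite sumEFin lee_fin (plik_paths _ M1 _ sx).
    apply: gkl_sum => z; last exact: zero.
      exact: (mulr_ge0 (P0 z) (pe0 z x)).
    exact: (ltW (mulr_gt0 (w0 z) (pc0 z x))).
rewrite tint_sum //.
apply: (@le_trans _ _ (\sum_(z : n.+1.-tuple 'I_k) (P z * G + P z * ln m + (w z - P z))%:E)%E).
  apply: lee_sum => z _; rewrite tint_gkl_scaled //.
  apply: (le_trans (leeD (lee_wpmul2l _ (hG z)) (lexx _))); first by rewrite lee_fin.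
  rewrite -EFinM -EFinD lee_fin addrA lerD2r lerD2l.
  have := P0 z; rewrite le_eqVlt => /orP[/eqP <-|Pz0]; first by rewrite !mul0r.
  rewrite ler_pM2l // ler_ln ?posrE ?divr_gt0 // ler_pdivrMr //.
  by apply: le_type_weight => // y /path_weight_type; exact.
rewrite sumEFin lee_fin !big_split /= -!mulr_suml P1 !mul1r sumrN P1 w1.
by rewrite subrr addr0 addrC.
Qed.

End path_mixture.

(** * Chain rule for conditional densities *)

Section kernel_measurability.
Context d (T : measurableType d) (R : realType).
Implicit Types (g : seq T -> T -> R) (f : seq T -> R).

Definition seq2_measurable g :=
  forall n, measurable_fun [set: n.-tuple T * T] (fun p => g (tval p.1) p.2).

Lemma seq2_measurable_rcons f : seq_measurable f -> seq2_measurable (fun x y => f (rcons x y)).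
Proof. by move=> mf n; exact: seq_measurable_rcons2. Qed.

Lemma seq2_measurable_fst f : seq_measurable f -> seq2_measurable (fun x _ => f x).
Proof. by move=> mf n; exact: (measurableT_comp (mf n) measurable_fst). Qed.

Lemma seq2_measurableM g h : seq2_measurable g -> seq2_measurable h ->
  seq2_measurable (fun x y => g x y * h x y).
Proof. by move=> mg mh n; apply: measurable_funM; [exact: mg|exact: mh]. Qed.

Lemma seq2_measurable_gkl g h : seq2_measurable g -> seq2_measurable h ->
  seq2_measurable (fun x y => gkl (g x y) (h x y)).
Proof. by move=> mg mh n; apply: measurable_gkl; [exact: mg|exact: mh]. Qed.

Lemma seq2_measurable_drop g m : seq2_measurable g -> seq2_measurable (fun x y => g (drop m x) y).
Proof.
move=> mg n.
have mdrop : measurable_fun [set: n.-tuple T] (fun w => drop_tuple m w).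
  apply: (measurable_fun_of_nth (x0 := point)) => i _.
  rewrite (_ : (fun u => _) = (fun w : n.-tuple T => nth point w (m + i))).
    exact: measurable_nth.
  by apply/funext => w; rewrite nth_drop.
have mpair : measurable_fun [set: n.-tuple T * T] (fun p => (drop_tuple m p.1, p.2)).
  by apply: measurable_fun_pair => //; exact: (measurableT_comp mdrop measurable_fst).
exact: (measurableT_comp (mg (n - m)%N) mpair).
Qed.

Lemma seq2_measurable_slice g n (w : n.-tuple T) : seq2_measurable g ->
  measurable_fun [set: T] (g w).
Proof. by move=> mg; exact: (measurableT_comp (mg n) (pair1_measurable w)). Qed.

Lemma seq_measurable_integral2 (mu : probability T R) g :
  seq2_measurable g -> (forall x y, 0 <= g x y) ->
  seq_measurable (fun x => \int[mu]_y (g x y)%:E)%E.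
Proof.
move=> mg g0 n.
apply: (measurable_fun_fubini_tonelli_F (fun p : n.-tuple T * T => (g p.1 p.2)%:E)) => //.
  by apply/measurable_EFinP; exact: mg.
by move=> p; rewrite lee_fin.
Qed.

Lemma seq_measurable_take f m : seq_measurable f -> seq_measurable (fun w => f (take m w)).
Proof.
move=> mf n; rewrite (_ : (fun w => _) = (fun w : n.-tuple T => f [seq nth point w i | i <- take m (iota 0 n)])).
  exact: seq_measurable_sel.
apply/funext => w; rewrite map_take; congr (f (take m _)).
by rewrite -[LHS](mkseq_nth point) size_tuple.
Qed.

End kernel_measurability.

Section chain_rule.
Context d (T : measurableType d) (R : realType).
Variable mu : probability T R.

(** [gkl_chain] integrated over the next letter. *)
Lemma integral_gkl_chain (p b : R) (A s : T -> R) :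
  measurable_fun [set: T] A -> measurable_fun [set: T] s ->
  0 <= p -> 0 < b -> (forall y, 0 <= A y) -> (forall y, 0 < s y) ->
  (p = 0 -> forall y, A y = 0) ->
  (\int[mu]_y (A y)%:E = p%:E)%E -> (\int[mu]_y (s y)%:E = 1)%E ->
  (\int[mu]_y (gkl (A y) (b * s y))%:E =
   (gkl p b)%:E + \int[mu]_y (gkl (A y) (p * s y))%:E)%E.
Proof.
move=> mA ms p0 b0 A0 s0 pA IA Is.
have iA : mu.-integrable setT (EFin \o A).
  apply/integrableP; split; first exact/measurable_EFinP.
  by under eq_integral do rewrite /= ger0_norm //; rewrite IA ltry.
have is_ : mu.-integrable setT (EFin \o s).
  apply/integrableP; split; first exact/measurable_EFinP.
  by under eq_integral do rewrite /= gtr0_norm //; rewrite Is ltry.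
pose r y := ln (p / b) * A y + (b - p) * s y.
have ir : mu.-integrable setT (EFin \o r).
  rewrite (_ : _ \o _ = (fun y => (ln (p / b))%:E * (A y)%:E + (b - p)%:E * (s y)%:E))%E.
    by apply: integrableD => //; exact: integrableZl.
  by apply/funext.
transitivity (\int[mu]_y ((gkl (A y) (p * s y))%:E + (r y)%:E))%E.
  apply: eq_integral => y _; rewrite -EFinD (@gkl_chain _ p) //; last by move=> h; exact: pA.
  by rewrite /r; congr EFin; ring.
rewrite integralD_ge0_integrable //; last 2 first.
- by apply/measurable_EFinP; apply: measurable_gkl => //; exact: measurable_funM.
- move=> y; rewrite lee_fin gkl_ge0 // ?mulr_ge0 // ?(ltW (s0 y)) //.
  by move=> /eqP; rewrite mulf_eq0 (gt_eqF (s0 y)) orbF => /eqP /pA.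
rewrite addeC; congr (_ + _)%E; under eq_integral do rewrite EFinD !EFinM.
rewrite integralD //; [|exact: integrableZl..].
rewrite !integralZl // IA Is mule1 -EFinM -EFinD /gkl; congr EFin; ring.
Qed.

Variables (N : nat) (q : seq T -> R) (c : R).
Hypotheses (mq : seq_measurable q) (c0 : 0 < c) (qc : forall s, c <= q s).
Hypothesis (qN : tint mu N (fun s => (q s)%:E) = 1%E).

(** Marginal density of an initial segment [x] under the law of density [q] on
    sequences of length [N]. *)
Definition marginal (x : seq T) : \bar R := tint mu (N - size x) (fun v => (q (x ++ v))%:E).

Let mqE : seq_measurable (fun s => (q s)%:E) := seq_measurable_EFin mq.
Let qE0 s : (0 <= (q s)%:E)%E. Proof. by rewrite lee_fin (le_trans (ltW c0)). Qed.

Lemma marginal_ge0 x : (0 <= marginal x)%E.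
Proof. by apply: tint_ge0 => v. Qed.

Lemma seq_measurable_marginal : seq_measurable marginal.
Proof.
move=> n; rewrite /marginal.
rewrite (_ : (fun w => _) = (fun w : n.-tuple T => tint mu (N - n) (fun v => (q (tval w ++ v))%:E))).
  exact: (@seq_measurable_tint _ _ _ mu (N - n) (fun s => (q s)%:E) mqE qE0 n).
by apply/funext => w; rewrite size_tuple.
Qed.

Lemma marginal_full x : size x = N -> marginal x = (q x)%:E.
Proof.
move=> sx; rewrite /marginal sx subnn tint0 ?cats0 //.
by have := seq_measurable_cat (in_tuple x) mqE.
Qed.

Lemma marginal_nil : marginal [::] = 1%E.
Proof. by rewrite /marginal subn0. Qed.

Lemma integral_marginal x : (size x < N)%N -> (\int[mu]_y marginal (rcons x y) = marginal x)%E.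
Proof.
move=> sx; rewrite [RHS]/marginal (_ : N - size x = 1 + (N - (size x).+1))%N; last first.
  by rewrite add1n subnSK.
have mx := seq_measurable_cat (in_tuple x) mqE.
have mx1 := seq_measurable_tint mu (N - (size x).+1) mx (fun v => qE0 _).
have x0 s : (0 <= tint mu (N - (size x).+1) (fun v => (q (x ++ (s ++ v)))%:E))%E by exact: tint_ge0.
rewrite tint_cat // tintS // tint0 //.
- by apply: eq_integral => y _; rewrite /marginal size_rcons -cats1; apply: eq_tint => v _; rewrite -catA.
- exact: (seq_measurable_integral mu mx1 x0).
- by move=> s; exact: integral_ge0.
Qed.

Lemma tint_marginal t : (t <= N)%N -> tint mu t marginal = 1%E.
Proof.
move=> tN; rewrite -[RHS]qN -[in RHS](subnKC tN) tint_cat //.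
by apply: eq_tint => x sx; rewrite /marginal sx.
Qed.

(** Marginals are finite only almost everywhere; the value [1] elsewhere keeps
    the conditional densities real and positive. *)
Definition rmarginal x : R := if marginal x \is a fin_num then fine (marginal x) else 1.

Definition cond_density x y : R :=
  if marginal x \is a fin_num then rmarginal (rcons x y) / rmarginal x else 1.

Lemma marginal_gt0 x : (0 < marginal x)%E.
Proof.
apply: (@lt_le_trans _ _ c%:E); first by rewrite lte_fin.
rewrite -(tint_cst mu (N - size x) c); apply: le_tint => //.
- by have := seq_measurable_cat (in_tuple x) mqE.
- by move=> _; rewrite lee_fin ltW.
- by move=> v _; rewrite lee_fin.
Qed.

Lemma rmarginal_gt0 x : 0 < rmarginal x.
Proof.
rewrite /rmarginal; case: ifPn => // xfin.
by rewrite -lte_fin fineK // marginal_gt0.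
Qed.

Lemma cond_density_gt0 x y : 0 < cond_density x y.
Proof. by rewrite /cond_density; case: ifPn => // _; rewrite divr_gt0 // rmarginal_gt0. Qed.

Lemma rmarginalE x : marginal x \is a fin_num -> (rmarginal x)%:E = marginal x.
Proof. by move=> xfin; rewrite /rmarginal xfin fineK. Qed.

Lemma rmarginal_full x : size x = N -> rmarginal x = q x.
Proof. by move=> sx; rewrite /rmarginal marginal_full. Qed.

Lemma rmarginal_nil : rmarginal [::] = 1.
Proof. by rewrite /rmarginal marginal_nil. Qed.

Lemma seq_measurable_fin_marginal : seq_measurable (fun x => marginal x \is a fin_num).
Proof.
move=> n; apply: (measurable_fun_bool true).
rewrite setTI; have := emeasurable_fin_num measurableT (@seq_measurable_marginal n).
by rewrite setTI.
Qed.

Lemma seq_measurable_rmarginal : seq_measurable rmarginal.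
Proof.
move=> n; apply: measurable_fun_ifT.
- exact: seq_measurable_fin_marginal.
- apply: (measurableT_comp _ (@seq_measurable_marginal n)).
  exact: fine_measurable.
- exact: measurable_cst.
Qed.

Lemma seq2_measurable_cond_density : seq2_measurable cond_density.
Proof.
move=> n; apply: measurable_fun_ifT.
- exact: (measurableT_comp (@seq_measurable_fin_marginal n) measurable_fst).
- apply: measurable_funM; first exact: (seq_measurable_rcons2 seq_measurable_rmarginal).
  apply: measurable_fun_inv.
  exact: (measurableT_comp (@seq_measurable_rmarginal n) measurable_fst).
- exact: measurable_cst.
Qed.

Lemma integral_cond_density x : (size x < N)%N -> (\int[mu]_y (cond_density x y)%:E = 1)%E.
Proof.
move=> sx; have mx := @seq_measurable_rcons _ _ _ _ marginal _ (in_tuple x) seq_measurable_marginal.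
have mrx := @seq_measurable_rcons _ _ _ _ rmarginal _ (in_tuple x) seq_measurable_rmarginal.
have [xfin|xinf] := boolP (marginal x \is a fin_num); last first.
  rewrite /cond_density (negbTE xinf) integral_cst // mul1e.
  exact: probability_setT.
have Ix := integral_marginal sx.
have xI : mu.-integrable setT (fun y => marginal (rcons x y)).
  apply/integrableP; split => //.
  under eq_integral do rewrite gee0_abs ?marginal_ge0 //.
  by rewrite Ix -ge0_fin_numE // marginal_ge0.
transitivity ((rmarginal x)^-1%:E * \int[mu]_y (rmarginal (rcons x y))%:E)%E.
  rewrite -ge0_integralZl //; last 3 first.
  - exact/measurable_EFinP.
  - by move=> y _; rewrite lee_fin ltW // rmarginal_gt0.
  - by rewrite lee_fin invr_ge0 ltW // rmarginal_gt0.
  by apply: eq_integral => y _; rewrite /cond_density xfin -EFinM mulrC.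
rewrite (_ : (\int[mu]_y _)%E = marginal x); last first.
  rewrite -Ix; apply: ae_eq_integral => //; first exact/measurable_EFinP.
  by have := integrable_ae measurableT xI; apply: filterS => y /(_ I) /rmarginalE.
by rewrite -rmarginalE // -EFinM mulVf // gt_eqF // rmarginal_gt0.
Qed.

Lemma ae_fin_marginal t : (t <= N)%N ->
  {ae tpow mu t, forall w, marginal (tval w) \is a fin_num}.
Proof.
move=> tN; have := @integrable_ae _ _ _ (tpow mu t) setT measurableT (fun w => marginal (tval w)).
case=> [|A [mA A0 sub]].
  apply/integrableP; split; first exact: seq_measurable_marginal.
  under eq_integral do rewrite gee0_abs ?marginal_ge0 //.
  by have := tint_marginal tN; rewrite /tint => ->; rewrite ltry.
by exists A; split => // w nw; apply: sub => /= /(_ I).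
Qed.

Variable p : seq T -> R.
Hypotheses (mp : seq_measurable p) (p0 : forall x, 0 <= p x).
Hypothesis (pI : forall x, (\int[mu]_y (p (rcons x y))%:E = (p x)%:E)%E).
Hypothesis (pz : forall x y, p x = 0 -> p (rcons x y) = 0).

Definition pred_risk x := (\int[mu]_y (gkl (p (rcons x y)) (p x * cond_density x y))%:E)%E.

Lemma gkl_pred_ge0 x y : 0 <= gkl (p (rcons x y)) (p x * cond_density x y).
Proof.
apply: gkl_ge0 => //; first by rewrite mulr_ge0 // ltW // cond_density_gt0.
by move=> /eqP; rewrite mulf_eq0 (gt_eqF (cond_density_gt0 _ _)) orbF => /eqP /pz.
Qed.

Lemma seq2_measurable_pred :
  seq2_measurable (fun x y => gkl (p (rcons x y)) (p x * cond_density x y)).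
Proof.
apply: seq2_measurable_gkl; first exact: seq2_measurable_rcons.
by apply: seq2_measurableM; [exact: seq2_measurable_fst|exact: seq2_measurable_cond_density].
Qed.

Lemma seq_measurable_pred_risk : seq_measurable pred_risk.
Proof. exact: (seq_measurable_integral2 _ seq2_measurable_pred gkl_pred_ge0). Qed.

Lemma gkl_rmarginal_ge0 x : 0 <= gkl (p x) (rmarginal x).
Proof.
apply: gkl_ge0 => //; first by rewrite ltW // rmarginal_gt0.
by move=> h; have := rmarginal_gt0 x; rewrite h ltxx.
Qed.

Lemma tint_gkl_step t : (t < N)%N ->
  (tint mu t.+1 (fun x => (gkl (p x) (rmarginal x))%:E) =
   tint mu t (fun x => (gkl (p x) (rmarginal x))%:E) + tint mu t pred_risk)%E.
Proof.
move=> tN; have mg : seq_measurable (fun x => (gkl (p x) (rmarginal x))%:E).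
  apply: seq_measurable_EFin => n; apply: measurable_gkl; [exact: mp|exact: seq_measurable_rmarginal].
have g0 x : (0 <= (gkl (p x) (rmarginal x))%:E)%E by rewrite lee_fin gkl_rmarginal_ge0.
have pr0 x : (0 <= pred_risk x)%E.
  by apply: integral_ge0 => y _; rewrite lee_fin gkl_pred_ge0.
rewrite tintS // -tintD //; last exact: seq_measurable_pred_risk.
apply: ae_eq_integral => //.
- by have := seq_measurable_integral mu mg g0 (n := t); exact.
- apply: emeasurable_funD; [exact: mg|exact: seq_measurable_pred_risk].
have := ae_fin_marginal (ltnW tN); apply: filterS => w wfin _.
rewrite -integral_gkl_chain //.
- by apply: eq_integral => y _; rewrite /cond_density wfin mulrC divfK // gt_eqF // rmarginal_gt0.
- exact: seq_measurable_rcons.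
- exact: (seq2_measurable_slice _ seq2_measurable_cond_density).
- exact: rmarginal_gt0.
- by move=> y; exact: cond_density_gt0.
- by move=> h y; exact: pz.
- by apply: integral_cond_density; rewrite size_tuple.
Qed.

(** Chain rule: the prediction losses of the conditional densities of [q] add
    up to the divergence between the joint laws. *)
Lemma sum_pred_risk : p [::] = 1 ->
  (\sum_(t < N) tint mu t pred_risk = tint mu N (fun x => (gkl (p x) (q x))%:E))%E.
Proof.
move=> p1.
have main t : (t <= N)%N ->
    (\sum_(i < t) tint mu i pred_risk = tint mu t (fun x => (gkl (p x) (rmarginal x))%:E))%E.
  elim: t => [|t ih] tN.
    rewrite big_ord0 tint0.
    - by rewrite rmarginal_nil p1 /gkl divr1 ln1 mulr0 sub0r addNr.
    - by apply: seq_measurable_EFin => n; apply: measurable_gkl; [exact: mp|exact: seq_measurable_rmarginal].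
    - by move=> x; rewrite lee_fin gkl_rmarginal_ge0.
  by rewrite big_ord_recr /= ih 1?ltnW // -tint_gkl_step.
rewrite main //; apply: eq_tint => x sx; by rewrite rmarginal_full.
Qed.

End chain_rule.

(** * Averaging forecasts over windows *)

Section prediction.
Context d (T : measurableType d) (R : realType) (k n : nat).
Variables (mu : probability T R) (M : 'M[R]_k) (e : 'I_k -> T -> R) (s : seq T -> T -> R).
Hypotheses (M1 : forall i, \sum_j M i j = 1) (M0 : forall i j, 0 <= M i j).
Hypotheses (me : forall i, measurable_fun setT (e i)) (e0 : forall i y, 0 <= e i y).
Hypotheses (ms : seq2_measurable s) (s0 : forall x y, 0 < s x y).

Implicit Types (v : 'rV[R]_k) (x : seq T) (y : T).

(** The forecast: an average over [t <= n] of the forecasts made by [s] from the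
    last [t] letters alone. *)
Definition avg_density (x : seq T) (y : T) : R :=
  n.+1%:R^-1 * \sum_(t < n.+1) s (drop (n - t) x) y.

(** On pasts of density zero, the value [1] makes the base law the conditional
    law. *)
Definition hmm_cond v (x : seq T) (y : T) : R :=
  if plik M e v x == 0 then 1 else plik M e v (rcons x y) / plik M e v x.

Let p a := plik M e (delta_mx ord0 a : 'rV[R]_k).

Let delta_ge0 (a i : 'I_k) : 0 <= (delta_mx ord0 a : 'rV[R]_k) ord0 i.
Proof. by rewrite mxE; case: (_ && _). Qed.

Lemma gkl_state_ge0 a x y : 0 <= gkl (p a (rcons x y)) (p a x * s x y).
Proof.
apply: gkl_ge0; [exact: plik_ge0|by rewrite mulr_ge0 ?plik_ge0 ?(ltW (s0 _ _))|].
move=> /eqP; rewrite mulf_eq0 (gt_eqF (s0 _ _)) orbF => /eqP; exact: plik_rcons_eq0.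
Qed.

Lemma avg_density_gt0 x y : 0 < avg_density x y.
Proof.
rewrite mulr_gt0 ?invr_gt0 // big_ord_recl ltr_wpDr //.
by apply: sumr_ge0 => t _; exact: ltW.
Qed.

Lemma hmm_cond_ge0 v x y : (forall i, 0 <= v ord0 i) -> 0 <= hmm_cond v x y.
Proof. by move=> v0; rewrite /hmm_cond; case: eqP => // _; rewrite divr_ge0 ?plik_ge0. Qed.

(** Predicting from the last [t] letters only costs the divergence that a
    forecaster who also knows the hidden state [a] at the start of this window
    would incur, averaged over [a]: the conditional law given the whole past is a
    mixture over [a] of the conditional laws given [a] and the window. *)
Lemma gkl_window v x y t : (forall i, 0 <= v ord0 i) ->
  gkl (plik M e v (rcons x y)) (plik M e v x * s (drop t x) y) <=
  \sum_a fwd M e v (take t x) ord0 a *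
    gkl (p a (rcons (drop t x) y)) (p a (drop t x) * s (drop t x) y).
Proof.
move=> v0; rewrite -{1 2}(cat_take_drop t x) rcons_cat !(plik_cat M e) mulr_suml.
apply: le_trans (gkl_sum _ _ _ _) _ => /=.
- by move=> a; rewrite mulr_ge0 ?fwd_ge0 ?plik_ge0.
- by move=> a; rewrite !mulr_ge0 ?fwd_ge0 ?plik_ge0 ?(ltW (s0 _ _)).
- move=> a /eqP; rewrite !mulf_eq0 (gt_eqF (s0 _ _)) orbF => /orP[/eqP->|/eqP h].
    by rewrite mul0r.
  by rewrite plik_rcons_eq0 ?mulr0.
by apply: ler_sum => a _; rewrite -mulrA gklM ?fwd_ge0.
Qed.

Lemma gkl_avg_density v x y : (forall i, 0 <= v ord0 i) ->
  plik M e v x * gkl (hmm_cond v x y) (avg_density x y) <=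
  n.+1%:R^-1 * \sum_(t < n.+1) \sum_a fwd M e v (take (n - t) x) ord0 a *
    gkl (p a (rcons (drop (n - t) x) y)) (p a (drop (n - t) x) * s (drop (n - t) x) y).
Proof.
move=> v0; have N0 : 0 <= n.+1%:R^-1 :> R by rewrite invr_ge0.
have [px0|px0] := eqVneq (plik M e v x) 0.
  rewrite px0 mul0r mulr_ge0 // sumr_ge0 // => t _; rewrite sumr_ge0 // => a _.
  by rewrite mulr_ge0 ?fwd_ge0 ?gkl_state_ge0.
have pp : 0 < plik M e v x by rewrite lt_neqAle eq_sym px0 plik_ge0.
rewrite -gklM ?plik_ge0 // /hmm_cond (negbTE px0) mulrCA divff // mulr1.
have -> : plik M e v (rcons x y) =
    \sum_(t < n.+1) n.+1%:R^-1 * plik M e v (rcons x y).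
  by rewrite sumr_const card_ord -[RHS]mulr_natl mulrA divff // mul1r.
have -> : plik M e v x * avg_density x y =
    \sum_(t < n.+1) n.+1%:R^-1 * (plik M e v x * s (drop (n - t) x) y).
  by rewrite -mulr_sumr -mulr_sumr /avg_density; ring.
apply: le_trans (gkl_sum _ _ _ _) _ => /=.
- by move=> t; rewrite mulr_ge0 ?plik_ge0.
- by move=> t; rewrite !mulr_ge0 ?plik_ge0 ?(ltW (s0 _ _)).
- move=> t /eqP; rewrite !mulf_eq0 (gt_eqF (s0 _ _)) (negbTE px0) /= orbF.
  by rewrite invr_eq0 pnatr_eq0.
rewrite [leRHS]mulr_sumr; apply: ler_sum => t _.
by rewrite gklM // ler_wpM2l // gkl_window.
Qed.

Hypothesis e1 : forall i, (\int[mu]_y (e i y)%:E = 1)%E.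
Hypothesis s1 : forall x, (size x <= n)%N -> (\int[mu]_y (s x y)%:E = 1)%E.

Lemma seq2_measurable_avg_density : seq2_measurable avg_density.
Proof.
move=> m; apply: measurable_funM => //; apply: measurable_sum => t.
exact: (@seq2_measurable_drop _ _ _ s (n - t) ms m).
Qed.

Lemma integral_avg_density x : size x = n -> (\int[mu]_y (avg_density x y)%:E = 1)%E.
Proof.
move=> sx; under eq_integral do rewrite EFinM -sumEFin.
have msx t : measurable_fun [set: T] (fun y => (s (drop t x) y)%:E).
  apply/measurable_EFinP; exact: (seq2_measurable_slice (in_tuple (drop t x)) ms).
have sE0 t y : (0 <= (s (drop t x) y)%:E)%E by rewrite lee_fin ltW.
rewrite ge0_integralZl //; last 2 first.
- by apply: emeasurable_sum => t.
- by move=> y _; apply: sume_ge0.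
rewrite ge0_integral_sum // (eq_bigr (fun=> 1%E)) => [|t _]; last first.
  by apply: s1; rewrite size_drop sx leq_subr.
by rewrite sumEFin sumr_const card_ord -EFinM mulVf.
Qed.

Lemma seq2_measurable_hmm_cond v : seq2_measurable (hmm_cond v).
Proof.
have mp := seq_measurable_plik M me v.
move=> m; apply: measurable_fun_ifT.
- apply: measurable_fun_eqr; last exact: measurable_cst.
  exact: (measurableT_comp (@mp m) measurable_fst).
- exact: measurable_cst.
- apply: measurable_funM; first exact: seq_measurable_rcons2.
  by apply: measurable_fun_inv; exact: (measurableT_comp (@mp m) measurable_fst).
Qed.

Lemma integral_hmm_cond v x : (forall i, 0 <= v ord0 i) -> (\int[mu]_y (hmm_cond v x y)%:E = 1)%E.
Proof.
move=> v0; rewrite /hmm_cond; case: eqVneq => [_|px0].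
  by rewrite integral_cst // mul1e; exact: probability_setT.
under eq_integral do rewrite mulrC EFinM.
have mp := @seq_measurable_rcons _ _ _ _ _ _ (in_tuple x) (seq_measurable_plik M me v).
rewrite ge0_integralZl //; last 3 first.
- exact/measurable_EFinP.
- by move=> y _; rewrite lee_fin plik_ge0.
- by rewrite lee_fin invr_ge0 plik_ge0.
by rewrite integral_plik // -EFinM mulVf.
Qed.

(** The loss at each window length is the loss of a forecaster told the hidden
    state at the start of the window; by stationarity that state has law [v],
    whatever the length of the window. *)
Lemma tint_avg_density v (B : R) : (forall i, 0 <= v ord0 i) -> \sum_i v ord0 i = 1 ->
  v *m M = v ->
  (forall a, (\sum_(t < n.+1) tint mu t (fun x =>
     \int[mu]_y (gkl (p a (rcons x y)) (p a x * s x y))%:E) <= B%:E)%E) ->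
  (tint mu n (fun x => (plik M e v x)%:E *
     \int[mu]_y (gkl (hmm_cond v x y) (avg_density x y))%:E) <= (n.+1%:R^-1 * B)%:E)%E.
Proof.
move=> v0 v1 vM hB.
pose g a x y := gkl (p a (rcons x y)) (p a x * s x y).
have g0 a x y : 0 <= g a x y by exact: gkl_state_ge0.
have mg a : seq2_measurable (g a).
  have mp := seq_measurable_plik M me (delta_mx ord0 a).
  apply: seq2_measurable_gkl; first exact: seq2_measurable_rcons.
  by apply: seq2_measurableM => //; exact: seq2_measurable_fst.
pose D a x := (\int[mu]_y (g a x y)%:E)%E.
have mD a : seq_measurable (D a) by exact: seq_measurable_integral2.
have D0 a x : (0 <= D a x)%E by apply: integral_ge0 => y _; rewrite lee_fin.
have mf t a : seq_measurable (fun x => (fwd M e v (take t x) ord0 a)%:E).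
  by apply: seq_measurable_EFin; exact: (seq_measurable_take _ (seq_measurable_fwd M me v a)).
have f0 t a x : (0 <= (fwd M e v (take t x) ord0 a)%:E)%E by rewrite lee_fin fwd_ge0.
pose H t a x := ((fwd M e v (take t x) ord0 a)%:E * D a (drop t x))%E.
have mH t a : seq_measurable (H t a).
  move=> m; apply: emeasurable_funM; first exact: mf.
  exact: (@seq_measurable_drop _ _ _ _ (D a) t (mD a) m).
have H0 t a x : (0 <= H t a x)%E by rewrite mule_ge0.
have N0 : 0 <= n.+1%:R^-1 :> R by rewrite invr_ge0.
have mk : seq2_measurable (fun x y => gkl (hmm_cond v x y) (avg_density x y)).
  by apply: seq2_measurable_gkl; [exact: seq2_measurable_hmm_cond|exact: seq2_measurable_avg_density].
have k0 x y : 0 <= gkl (hmm_cond v x y) (avg_density x y).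
  apply: gkl_ge0; [exact: hmm_cond_ge0|exact/ltW/avg_density_gt0|].
  by move=> h; have := avg_density_gt0 x y; rewrite h ltxx.
apply: (@le_trans _ _ (tint mu n (fun x =>
    n.+1%:R^-1%:E * \sum_(t < n.+1) \sum_a H (n - t)%N a x)%E)).
  apply: le_tint => [m|m|x|x sx].
  - apply: emeasurable_funM.
      exact: (seq_measurable_EFin (seq_measurable_plik M me v)).
    exact: (seq_measurable_integral2 mu mk k0).
  - apply: measurable_funeM; apply: emeasurable_sum => t; apply: emeasurable_sum => a.
    exact: mH.
  - by rewrite mule_ge0 ?lee_fin ?plik_ge0 // integral_ge0 // => y _; rewrite lee_fin.
  have mkx : measurable_fun setT (fun y => (gkl (hmm_cond v x y) (avg_density x y))%:E).
    by apply/measurable_EFinP; exact: (seq2_measurable_slice (in_tuple x) mk).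
  rewrite -ge0_integralZl //; last 2 first.
  - by move=> y _; rewrite lee_fin.
  - by rewrite lee_fin plik_ge0.
  have mgx t a : measurable_fun setT (fun y => (g a (drop t x) y)%:E).
    by apply/measurable_EFinP; exact: (seq2_measurable_slice (in_tuple (drop t x)) (mg a)).
  apply: (@le_trans _ _ (\int[mu]_y (n.+1%:R^-1%:E * \sum_(t < n.+1) \sum_a
      (fwd M e v (take (n - t) x) ord0 a)%:E * (g a (drop (n - t) x) y)%:E))%E).
    apply: ge0_le_integral => //.
    - by move=> y _; rewrite mule_ge0 ?lee_fin ?plik_ge0.
    - exact: measurable_funeM.
    - apply: measurable_funeM; apply: emeasurable_sum => t; apply: emeasurable_sum => a.
      exact: measurable_funeM.
    - move=> y _; rewrite -EFinM.
      under eq_bigr do (under eq_bigr do rewrite -EFinM; rewrite sumEFin).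
      by rewrite sumEFin -EFinM lee_fin gkl_avg_density.
  rewrite ge0_integralZl //; last 2 first.
  - by apply: emeasurable_sum => t; apply: emeasurable_sum => a; exact: measurable_funeM.
  - by move=> y _; apply: sume_ge0 => t _; apply: sume_ge0 => a _; rewrite mule_ge0 // lee_fin.
  apply: lee_wpmul2l; first by rewrite lee_fin.
  rewrite ge0_integral_sum //; last 2 first.
  - by move=> t; apply: emeasurable_sum => a; exact: measurable_funeM.
  - by move=> t y _; apply: sume_ge0 => a _; rewrite mule_ge0 // lee_fin.
  apply: lee_sum => t _; rewrite ge0_integral_sum //; last 2 first.
  - by move=> a; exact: measurable_funeM.
  - by move=> a y _; rewrite mule_ge0 // lee_fin.
  by apply: lee_sum => a _; rewrite ge0_integralZl // => y _; rewrite lee_fin.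
rewrite tintZ //; last 2 first.
- by move=> m; apply: emeasurable_sum => t; apply: emeasurable_sum => a; exact: mH.
- by move=> x; apply: sume_ge0 => t _; apply: sume_ge0 => a _.
rewrite EFinM lee_pmul2l ?lte_fin ?invr_gt0 // tint_sum; last 2 first.
- by move=> t m; apply: emeasurable_sum => a; exact: mH.
- by move=> t x; apply: sume_ge0 => a _.
have window (t : 'I_n.+1) a : tint mu n (H (n - t)%N a) = ((v ord0 a)%:E * tint mu t (D a))%E.
  have tn : (t <= n)%N by rewrite -ltnS.
  transitivity (tint mu (n - t + t)%N (H (n - t)%N a)); first by rewrite subnK.
  rewrite tint_cat //.
  transitivity (tint mu (n - t) (fun u => (fwd M e v u ord0 a)%:E * tint mu t (D a))%E).
    apply: eq_tint => u su; rewrite /tint -ge0_integralZl //; last 2 first.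
    - exact: mD.
    - by rewrite lee_fin fwd_ge0.
    apply: eq_integral => x _; rewrite /H.
    by rewrite take_size_cat // drop_size_cat.
  rewrite /tint ge0_integralZr //; last 3 first.
  - exact: (seq_measurable_EFin (seq_measurable_fwd M me v a)).
  - by move=> u _; rewrite lee_fin fwd_ge0.
  - exact: integral_ge0.
  by congr (_ * _)%E; exact: tint_fwd.
under eq_bigr do rewrite tint_sum //; under eq_bigr do (under eq_bigr do rewrite window).
rewrite exchange_big /=.
apply: (@le_trans _ _ (\sum_a (v ord0 a * B)%:E)%E).
  apply: lee_sum => a _; rewrite -ge0_sume_distrr; last by move=> t _; exact: tint_ge0.
  by rewrite EFinM; apply: lee_wpmul2l; [rewrite lee_fin|exact: hB].
by rewrite sumEFin -mulr_suml v1 mul1r.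
Qed.
End prediction.

(** * Laws and kernels given by densities *)

Section measure_of_density.
Context d (T : measurableType d) (R : realType).
Variables (mu : {measure set T -> \bar R}) (f : T -> R).

(** The hypotheses on [f] are arguments, which lets the measure and probability
    structures be inferred. *)
Definition dens_measure of measurable_fun [set: T] f & (forall x, 0 <= f x)
    & (\int[mu]_x (f x)%:E = 1)%E : set T -> \bar R :=
  fun A => (\int[mu]_(x in A) (f x)%:E)%E.

Hypotheses (mf : measurable_fun [set: T] f) (f0 : forall x, 0 <= f x).
Hypothesis (f1 : (\int[mu]_x (f x)%:E = 1)%E).

Local Notation nu := (dens_measure mf f0 f1).

Let nu0 : nu set0 = 0%E. Proof. by rewrite /nu integral_set0. Qed.

Let nu_ge0 A : (0 <= nu A)%E.
Proof. by apply: integral_ge0 => x _; rewrite lee_fin. Qed.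

Let nu_sigma_additive : semi_sigma_additive nu.
Proof.
move=> F mF tF mU; rewrite /dens_measure ge0_integral_bigcup //.
- by apply: is_cvg_nneseries => n _ _; exact: nu_ge0.
- by apply/measurable_funTS/measurable_EFinP.
- by move=> x _; rewrite lee_fin.
Qed.

HB.instance Definition _ := isMeasure.Build _ _ _ nu nu0 nu_ge0 nu_sigma_additive.
HB.instance Definition _ := Measure_isProbability.Build _ _ _ nu f1.

Definition dens_prob : probability T R := nu.

Lemma dens_prob_density : is_density mu dens_prob f.
Proof. by split. Qed.

End measure_of_density.

Section density_kernel.
Context d (T : measurableType d) (R : realType) (n : nat).
Variables (mu : probability T R) (s : n.-tuple T -> T -> R).
Hypotheses (ms : measurable_fun [set: n.-tuple T * T] (fun p => s p.1 p.2)).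
Hypotheses (s0 : forall x y, 0 <= s x y) (s1 : forall x, (\int[mu]_y (s x y)%:E = 1)%E).

Let msx x : measurable_fun [set: T] (s x).
Proof. exact: (measurableT_comp ms (pair1_measurable x)). Qed.

(** The sigma-algebra on laws is generated by evaluations at measurable sets, and
    these are integrals of a jointly measurable density. *)
Lemma ex_density_kernel : exists K : {mfun n.-tuple T >-> pprobability T R},
  forall x, is_density mu (K x : probability T R) (s x).
Proof.
pose K x : pprobability T R := dens_prob (msx x) (s0 x) (s1 x).
have mK : measurable_fun [set: n.-tuple T] K.
  apply: (measurability (@pset _ _ _ : set (set (pprobability T R)))) => //.
  move=> _ -[_ [r r01] [U mU <-]] <-.
  apply: emeasurable_fun_infty_o => //.
  rewrite (_ : (fun x => _) = (fun x => \int[mu]_y ((\1_U y)%:E * (s x y)%:E))%E).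
    apply: (measurable_fun_fubini_tonelli_F (fun p : n.-tuple T * T => (\1_U p.2)%:E * (s p.1 p.2)%:E)%E).
      apply: emeasurable_funM; last exact/measurable_EFinP.
      apply/measurable_EFinP; apply: (measurableT_comp _ measurable_snd).
      exact: measurable_indic.
    by move=> p; rewrite mule_ge0 // lee_fin.
  apply/funext => x; rewrite /K /= /dens_measure integral_mkcond.
  by apply: eq_integral => y _; rewrite epatch_indic /= muleC.
exists (HB.pack_for {mfun n.-tuple T >-> pprobability T R} K
  (isMeasurableFun.Build _ _ _ _ _ mK)) => x.
exact: dens_prob_density.
Qed.
End density_kernel.

Section box_unique.
Context d (T : measurableType d) (R : realType) (n : nat).

Definition box (B : 'I_n -> set T) : set (n.-tuple T) := [set w | forall i, B i (tnth w i)].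

Lemma measurable_box B : (forall i, measurable (B i)) -> measurable (box B).
Proof.
move=> mB; rewrite (_ : box B = \bigcap_(i in [set: 'I_n]) (fun w : n.-tuple T => tnth w i) @^-1` B i).
  apply: fin_bigcap_measurable => // i _; rewrite -[X in measurable X]setTI.
  exact: measurable_tnth.
by apply/seteqP; split => [w h i _|w h i]; [exact: h|exact: (h i)].
Qed.

(** Boxes form a pi-system that generates the product sigma-algebra. *)
Lemma box_unique (m1 m2 : {measure set (n.-tuple T) -> \bar R}) :
  (m1 setT < +oo)%E ->
  (forall B, (forall i, measurable (B i)) -> m1 (box B) = m2 (box B)) ->
  forall A, measurable A -> m1 A = m2 A.
Proof.
move=> fin m12 A mA.
pose G : set (set (n.-tuple T)) := [set box B | B in [set B | forall i, measurable (B i)]].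
have GT : G setT.
  by exists (fun=> setT) => //; apply/seteqP; split.
apply: (measure_unique G (fun=> setT)) => //.
- apply/seteqP; split => [C|C].
    apply: smallest_sub; first exact: smallest_sigma_algebra.
    move=> X; rewrite -bigcup_seq /= => -[i _ [Y mY <-]]; rewrite setTI.
    apply: sub_sigma_algebra; exists (fun j => if j == i then Y else setT).
      by move=> j /=; case: ifP.
    apply/seteqP; split => [w /= /(_ i)|w /= Yw j]; first by rewrite eqxx.
    by case: eqP => [->|].
  apply: smallest_sub; first exact: sigma_algebra_measurable.
  by move=> _ [B mB <-]; exact: measurable_box.
- move=> _ _ [B mB <-] [B' mB' <-]; exists (fun i => B i `&` B' i).
    by move=> i /=; exact: measurableI.
  by apply/seteqP; split => [w h|w [h1 h2] i]; [split => i; have [] := h i|split; [exact: h1|exact: h2]].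
- by apply/seteqP; split => // x _; exists 0%N.
- by move=> _ [B mB <-]; exact: m12.
Qed.

End box_unique.

(** * The law of the observations *)

Section hmm_law.
Context d (T : measurableType d) (R : realType) (k : nat).
Variables (mu : probability T R) (M : 'M[R]_k) (e : 'I_k -> T -> R) (emis : 'I_k -> probability T R).
Hypotheses (M1 : forall i, \sum_j M i j = 1) (M0 : forall i j, 0 <= M i j).
Hypothesis de : forall i, is_density mu (emis i) (e i).
Variable i0 : 'I_k.

Let me i : measurable_fun setT (e i). Proof. by case: (de i). Qed.
Let e0 i y : 0 <= e i y. Proof. by case: (de i). Qed.

Definition box_indic (B : nat -> set T) (x : seq T) : R :=
  \prod_(t < size x) \1_(B t) (nth point x t).

Lemma box_indic_rcons B x y : box_indic B (rcons x y) = box_indic B x * \1_(B (size x)) y.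
Proof.
rewrite /box_indic size_rcons big_ord_recr /= nth_rcons ltnn eqxx; congr (_ * _).
by apply: eq_bigr => t _; rewrite nth_rcons ltn_ord.
Qed.

Lemma box_indic_ge0 B x : 0 <= box_indic B x.
Proof. by apply: prodr_ge0. Qed.

Lemma seq_measurable_box_indic B : (forall t, measurable (B t)) -> seq_measurable (box_indic B).
Proof.
move=> mB n; rewrite (_ : (fun w => _) = (fun w : n.-tuple T => \prod_(t < n) \1_(B t) (nth point w t) : R)).
  apply: measurable_prod => t _; apply: (measurableT_comp (measurable_indic (mB t))).
  exact: measurable_nth.
by apply/funext => w; rewrite /box_indic size_tuple.
Qed.

Lemma box_indicE n B (w : n.-tuple T) : box_indic B w = \1_(box (fun i : 'I_n => B i)) w.
Proof.
rewrite /box_indic size_tuple indicE.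
have [/set_mem h|/negP h] := boolP (w \in box _).
  rewrite big1 // => t _; rewrite indicE mem_set //.
  by have := h t; rewrite (tnth_nth point).
apply/eqP; apply/prodf_eq0; apply: contrapT => h'.
apply: h; rewrite inE => i; apply: contrapT => Bi; apply: h'.
by exists i => //; rewrite indicE memNset // -tnth_nth.
Qed.

Lemma tint_path_box z B : (forall t, measurable (B t)) ->
  (tint mu (size z) (fun x => (path_emission e z x * box_indic B x)%:E) =
   \prod_(t < size z) emis (nth i0 z t) (B t))%E.
Proof.
move=> mB; have mpb y : seq_measurable (fun x => (path_emission e y x * box_indic B x)%:E).
  apply: seq_measurable_EFin => n; apply: measurable_funM.
    exact: (seq_measurable_path_emission me y).
  exact: seq_measurable_box_indic.
have pe0 y x : 0 <= path_emission e y x by apply: prodr_ge0 => i _; exact: prodr_ge0.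
have pb0 y x : (0 <= (path_emission e y x * box_indic B x)%:E)%E.
  by rewrite lee_fin mulr_ge0 // box_indic_ge0.
elim/last_ind: z => [|z i ih].
  rewrite tint0 // big_ord0 /path_emission /box_indic big_ord0 mulr1 big1 // => j _.
  by rewrite big_nil.
rewrite size_rcons big_ord_recr /= nth_rcons ltnn eqxx tintS //.
rewrite (eq_bigr (fun t : 'I_(size z) => emis (nth i0 z t) (B t))) => [|t _]; last first.
  by rewrite nth_rcons ltn_ord.
rewrite -ih /tint -ge0_integralZr //; last exact: mpb.
apply: eq_integral => w _.
transitivity (\int[mu]_y ((path_emission e z w * box_indic B w)%:E * (\1_(B (size z)) y * e i y)%:E))%E.
  apply: eq_integral => y _; rewrite box_indic_rcons path_emission_rcons ?size_tuple // -EFinM.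
  by congr EFin; ring.
rewrite ge0_integralZl //; last 2 first.
- by apply/measurable_EFinP; apply: measurable_funM => //; exact: measurable_indic.
- by move=> y _; rewrite lee_fin mulr_ge0.
congr (_ * _)%E; have [_ _ ->] // := de i.
rewrite [RHS]integral_mkcond; apply: eq_integral => y _; rewrite epatch_indic /= EFinM muleC //.
Qed.

Lemma path_weight_nth v z : (0 < size z)%N -> path_weight M v z =
  v ord0 (nth i0 z 0) * \prod_(t < (size z).-1) M (nth i0 z t) (nth i0 z t.+1).
Proof.
case: z => // i z _ /=; congr (_ * _).
rewrite (big_nth (i0, i0)) size_pairmap big_mkord; apply: eq_bigr => t _.
by rewrite (nth_pairmap i0).
Qed.

(** Partition by the hidden path, then use the conditional independence of the
    observations. *)
Lemma hmm_box d' (Omega : measurableType d') (Pr : probability Omega R) init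
    (Z : nat -> Omega -> 'I_k) (X : nat -> {RV Pr >-> T}) n B :
  is_stationary_hmm init M emis Z X -> (forall t, measurable (B t)) ->
  Pr [set w | forall t, (t <= n)%N -> B t (X t w)] =
  (\sum_(z : n.+1.-tuple 'I_k) (path_weight M init z)%:E * \prod_(t < n.+1) emis (nth i0 z t) (B t))%E.
Proof.
move=> hmm mB.
pose E (z : n.+1.-tuple 'I_k) := [set w | forall t, (t <= n)%N -> Z t w = nth i0 z t /\ B t (X t w)].
have -> : [set w | forall t, (t <= n)%N -> B t (X t w)] = \bigcup_(z in [set: n.+1.-tuple 'I_k]) E z.
  apply/seteqP; split => [w h|w [z _ h] t tn]; last by have [] := h t tn.
  exists [tuple Z t w | t < n.+1] => // t tn; split; last exact: h.
  by rewrite -[t]/(nat_of_ord (Ordinal (tn : t < n.+1)%N)) -tnth_nth tnth_mktuple.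
have mE z : measurable (E z).
  rewrite (_ : E z = \bigcap_(t in [set t | (t <= n)%N]) ([set w | Z t w = nth i0 z t] `&` X t @^-1` B t)).
    apply: fin_bigcap_measurable; first exact: (finite_II n.+1).
    move=> t _; apply: measurableI; first exact: (hmm_measurable_state hmm).
    by rewrite -[Y in measurable Y]setTI; exact: measurable_funP.
  by apply/seteqP; split.
have fT : finite_set [set: n.+1.-tuple 'I_k] by exact: finite_finset.
rewrite measure_fin_bigcup //; last first.
  move=> z z' _ _ [w [h h']]; apply/val_inj/(eq_from_nth (x0 := i0)); rewrite ?size_tuple // => t tn.
  by have [<- _] := h t tn; have [<- _] := h' t tn.
rewrite (_ : [set: n.+1.-tuple 'I_k] = [set` index_enum (n.+1.-tuple 'I_k)]); last first.
  by apply/seteqP; split => z //= _; exact: mem_index_enum.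
rewrite -fsbig_seq ?index_enum_uniq //; apply: eq_bigr => z _.
apply: (etrans (hmm_emission hmm n (nth i0 z) mB)); congr (_ * _)%E.
by apply: (etrans (hmm_markov hmm n (nth i0 z))); rewrite path_weight_nth size_tuple.
Qed.

(** Boxes determine the law of the observations, and on a box both sides expand
    into the same sum over hidden paths. *)
Lemma hmm_density d' (Omega : measurableType d') (Pr : probability Omega R) init
    (Z : nat -> Omega -> 'I_k) (X : nat -> {RV Pr >-> T}) n (P : probability (n.+1.-tuple T) R) :
  is_stationary_hmm init M emis Z X ->
  (forall A, measurable A -> P A = Pr [set w | A [tuple X t w | t < n.+1]]) ->
  is_density (tpow mu n.+1) P (plik M e init).
Proof.
move=> hmm PE.
have init0 := hmm_init_ge0 hmm; have init1 := hmm_init_sum hmm.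
have e1 i : (\int[mu]_y (e i y)%:E = 1)%E := integral_density1 (de i).
have mp := seq_measurable_plik M me init.
have p0 x : 0 <= plik M e init x by exact: plik_ge0.
have pw0 z : 0 <= path_weight M init z by exact: path_weight_ge0.
have pe0 z x : 0 <= path_emission e z x by apply: prodr_ge0 => i _; exact: prodr_ge0.
have Ip m : tint mu m (fun x => (plik M e init x)%:E) = 1%E.
  elim: m => [|m ih]; first by rewrite tint0 /plik /= ?init1 //; exact: seq_measurable_EFin.
  rewrite tintS ?(eq_tint _ (g := fun x => (plik M e init x)%:E)) //.
  - by move=> x _; rewrite integral_plik.
  - exact: seq_measurable_EFin.
split; [exact: mp|by []|].
apply: (@box_unique _ _ _ _ P (dens_prob (mp n.+1) (fun w => p0 w) (Ip n.+1))).
  by rewrite (le_lt_trans (probability_le1 _ _)) ?ltry.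
move=> B mB; pose B' t := if insub t is Some i then B i else setT.
have mB' t : measurable (B' t) by rewrite /B'; case: insub.
have B'E (i : 'I_n.+1) : B' i = B i by rewrite /B' valK.
have boxE : box B = box (fun i : 'I_n.+1 => B' i).
  by apply/seteqP; split => w h i; have := h i; rewrite B'E.
apply: (etrans (PE _ (measurable_box mB))).
transitivity (Pr [set w | forall t, (t <= n)%N -> B' t (X t w)]).
  congr (Pr _); rewrite boxE; apply/seteqP; split => w h => [t tn|i].
    by have := h (Ordinal (tn : t < n.+1)%N); rewrite tnth_mktuple.
  by rewrite tnth_mktuple; apply: h; rewrite -ltnS.
rewrite (hmm_box n hmm mB') /= /dens_measure integral_mkcond boxE.
transitivity (tint mu n.+1 (fun x => \sum_(z : n.+1.-tuple 'I_k)
    (path_weight M init z)%:E * (path_emission e z x * box_indic B' x)%:E)%E).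
  rewrite tint_sum; last 2 first.
  - move=> z m; apply: measurable_funeM; apply/measurable_EFinP/measurable_funM.
      exact: (seq_measurable_path_emission me z).
    exact: seq_measurable_box_indic.
  - by move=> z x; rewrite mule_ge0 // lee_fin // mulr_ge0 // box_indic_ge0.
  apply: eq_bigr => z _; rewrite tintZ //.
  - by have := @tint_path_box z B' mB'; rewrite size_tuple => ->.
  - apply: seq_measurable_EFin => m; apply: measurable_funM.
      exact: (seq_measurable_path_emission me z).
    exact: seq_measurable_box_indic.
  - by move=> x; rewrite lee_fin mulr_ge0 // box_indic_ge0.
apply: eq_integral => w _; rewrite epatch_indic /= -(box_indicE B' w) (plik_paths _ M1 _ (size_tuple w)).
rewrite -EFinM mulr_suml -sumEFin; apply: eq_bigr => z _.
by rewrite -EFinM mulrA.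
Qed.

End hmm_law.

(** * Conditional law and conditional divergence *)

Section prediction_law.
Context d (T : measurableType d) (R : realType) (n : nat).
Variables (mu : probability T R) (P : probability (n.+1.-tuple T) R).
Variables (p : seq T -> R) (c : seq T -> T -> R) (K : predictor T R n).
Hypotheses (mp : seq_measurable p) (p0 : forall x, 0 <= p x).
Hypothesis dP : is_density (tpow mu n.+1) P (fun w => p w).
Hypotheses (mc : seq2_measurable c) (c0 : forall x y, 0 <= c x y).
Hypothesis pc : forall x y, p (rcons x y) = p x * c x y.
Hypothesis pI : forall x, (\int[mu]_y (p (rcons x y))%:E = (p x)%:E)%E.
Hypothesis dK : forall x, is_density mu (K x : probability T R) (c x).

Lemma past_rcons (x : n.-tuple T) y : past (rcons_tuple x y) = x.
Proof.
apply: eq_from_tnth => i; rewrite tnth_mktuple !(tnth_nth y) /= nth_rcons size_tuple.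
by rewrite ltn_ord.
Qed.

Lemma future_rcons (x : n.-tuple T) y : future (rcons_tuple x y) = y.
Proof. by rewrite /future (tnth_nth y) /= nth_rcons size_tuple ltnn eqxx. Qed.

Lemma measurable_past : measurable_fun [set: n.+1.-tuple T] (@past T n).
Proof.
apply/measurable_fun_tnthP => i.
rewrite (_ : _ \o _ = fun w => tnth w (widen_ord (leqnSn n) i)); first exact: measurable_tnth.
by apply/funext => w /=; rewrite tnth_mktuple.
Qed.

Lemma measurable_future : measurable_fun [set: n.+1.-tuple T] (@future T n).
Proof. exact: measurable_tnth. Qed.

Let mpE : measurable_fun [set: n.+1.-tuple T] (fun w => (p w)%:E).
Proof. by apply/measurable_EFinP; exact: mp. Qed.

Lemma integral_past (F : n.-tuple T -> \bar R) :
  measurable_fun [set: n.-tuple T] F -> (forall x, 0 <= F x)%E ->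
  (\int[P]_w F (past w) = \int[tpow mu n]_x (F x * (p x)%:E))%E.
Proof.
move=> mF F0; have mFp := measurableT_comp mF measurable_past.
rewrite (ge0_integral_density (h := F \o @past T n) dP) //; last by move=> w; exact: F0.
rewrite ge0_integral_tpowS //; last 2 first.
- exact: emeasurable_funM.
- by move=> w; apply: mule_ge0; [exact: F0|rewrite lee_fin].
apply: eq_integral => x _ /=; under eq_integral do rewrite past_rcons.
have mpx := @seq_measurable_rcons _ _ _ _ _ _ x mp.
by rewrite ge0_integralZl ?pI //; [exact/measurable_EFinP|move=> y _; rewrite lee_fin].
Qed.

(** The conditional density is the ratio of the joint density to that of the
    past, so both sides are the same iterated integral. *)
Lemma density_cond_law : is_cond_law P K.
Proof.
move=> A B mA mB.
pose IA (x : n.-tuple T) : \bar R := (\1_A x)%:E.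
pose IB (y : T) : \bar R := (\1_B y)%:E.
have mIA : measurable_fun [set: n.-tuple T] IA by apply/measurable_EFinP; exact: measurable_indic.
have mIB : measurable_fun [set: T] IB by apply/measurable_EFinP; exact: measurable_indic.
have IA0 x : (0 <= IA x)%E by rewrite lee_fin.
have IB0 y : (0 <= IB y)%E by rewrite lee_fin.
have mKB : measurable_fun [set: n.-tuple T] (fun x => (K x : probability T R) B).
  exact: (measurable_kernel (kprobability (measurable_funP K)) B mB).
have mpA : measurable (@past T n @^-1` A).
  by rewrite -[X in measurable X]setTI; exact: measurable_past.
have mfB : measurable (@future T n @^-1` B).
  by rewrite -[X in measurable X]setTI; exact: measurable_future.
transitivity (\int[P]_w (IA (past w) * IB (future w)))%E.
  transitivity (P (past @^-1` A `&` future @^-1` B `&` setT)); first by rewrite setIT.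
  have <- := integral_indic P measurableT (measurableI _ _ mpA mfB).
  by apply: eq_integral => w _; rewrite -EFinM indicI.
transitivity (\int[P]_w (IA (past w) * (K (past w) : probability T R) B))%E; last first.
  rewrite [RHS]integral_mkcond; apply: eq_integral => w _.
  by rewrite epatch_indic muleC.
rewrite (@integral_past (fun x => IA x * (K x : probability T R) B)%E) //; last 2 first.
- exact: emeasurable_funM.
- by move=> x; rewrite mule_ge0.
have mIp := measurableT_comp mIA measurable_past.
have mIf := measurableT_comp mIB measurable_future.
rewrite (ge0_integral_density (h := fun w => (IA (past w) * IB (future w))%E) dP) //; last 2 first.
- exact: emeasurable_funM.
- by move=> w; rewrite mule_ge0.
rewrite ge0_integral_tpowS //; last 2 first.
- by apply: emeasurable_funM => //; exact: emeasurable_funM.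
- by move=> w; rewrite !mule_ge0 // lee_fin.
apply: eq_integral => x _.
have [mcx _ ->] := dK x => //.
transitivity (\int[mu]_y ((IA x * (p x)%:E) * (IB y * (c x y)%:E)))%E.
  by apply: eq_integral => y _; rewrite past_rcons future_rcons /= pc EFinM !muleA; congr (_ * _)%E; rewrite -!muleA; congr (_ * _)%E; rewrite muleC.
rewrite ge0_integralZl //; last 3 first.
- by apply: emeasurable_funM => //; exact/measurable_EFinP.
- by move=> y _; rewrite mule_ge0 // lee_fin.
- by rewrite mule_ge0 // lee_fin.
rewrite [in RHS]integral_mkcond muleAC; congr (_ * _ * _)%E.
by apply: eq_integral => y _; rewrite epatch_indic muleC.
Qed.

Variables (s : seq T -> T -> R) (Q : predictor T R n).
Hypotheses (ms : seq2_measurable s) (s0 : forall x y, 0 < s x y).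
Hypothesis dQ : forall x, is_density mu (Q x : probability T R) (s x).

(** An upper bound on an infimum over versions of the conditional law: it is
    enough to exhibit the version [K]. *)
Lemma cond_KL_le :
  (cond_KL P Q <= tint mu n (fun x => (p x)%:E * \int[mu]_y (gkl (c x y) (s x y))%:E))%E.
Proof.
have mg : seq2_measurable (fun x y => gkl (c x y) (s x y)) by exact: seq2_measurable_gkl.
have g0 x y : 0 <= gkl (c x y) (s x y).
  by apply: gkl_ge0 => //; [exact: ltW|move=> h; have := s0 x y; rewrite h ltxx].
have KLE (x : n.-tuple T) : KL (K x) (Q x) = (\int[mu]_y (gkl (c x y) (s x y))%:E)%E.
  exact: KL_gkl.
have mKL : measurable_fun [set: n.-tuple T] (fun x => KL (K x) (Q x) : \bar R).
  under eq_fun do rewrite KLE.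
  exact: (seq_measurable_integral2 mu mg g0 (n := n)).
apply: le_trans (ereal_inf_lbound _) _; first by exists K; [split; [exact: density_cond_law|exact: mKL]|reflexivity].
rewrite (@integral_past (fun x => KL (K x) (Q x))) //.
  by rewrite le_eqVlt; apply/orP; left; apply/eqP; apply: eq_integral => x _; rewrite KLE muleC.
by move=> x; rewrite KLE; apply: integral_ge0 => y _; rewrite lee_fin.
Qed.

End prediction_law.

(** * The prediction risk *)

Section risk.
Context d (T : measurableType d) (R : realType).
Variables (Qs : set (probability T R)) (rho : R -> R) (n k : nat).
Hypotheses (rho0 : forall x, 0 <= x -> 0 <= rho x) (crho : concave_on_nonneg rho).
Hypothesis hRed : forall t : nat, (Red (iid_class Qs t) <= (rho t%:R)%:E)%E.
Hypothesis k0 : (0 < k)%N.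

(** The forecast averages the conditional densities of [path_mixture] over
    windows; its positivity makes the loss of any law of the class an integral of
    [gkl], hence a measurable function of the past. *)
Lemma Risk_hmm_le :
  (Risk (hmm_class n k Qs) <= (n.+1%:R^-1 *
     (ln #|@markov_type k n @: [set: n.+1.-tuple 'I_k]%SET|%:R +
      (k%:R * rho (n.+1%:R / k%:R) + k%:R * (1 + ln 2))))%:E)%E.
Proof.
have [mu hmu] := ex_base_measure hRed.
have [q [mq q2 q1 hq]] := ex_block_density mu hRed.
have q0 x : 0 < q x by rewrite (lt_le_trans _ (q2 x)).
pose qm := @path_mixture d T R k n q.
have mqm : seq_measurable qm by exact: seq_measurable_path_mixture.
have c0 : 0 < 2^-1 ^+ k :> R by rewrite exprn_gt0 // invr_gt0.
have qm2 x : 2^-1 ^+ k <= qm x by exact: path_mixture_ge.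
have qm1 : tint mu n.+1 (fun x => (qm x)%:E) = 1%E by exact: tint_path_mixture.
pose s := cond_density mu n.+1 qm.
have ms : seq2_measurable s by exact: (seq2_measurable_cond_density mu n.+1 mqm c0 qm2).
have s0 x y : 0 < s x y by exact: (cond_density_gt0 mu n.+1 mqm c0 qm2).
have s1 x : (size x <= n)%N -> (\int[mu]_y (s x y)%:E = 1)%E.
  by move=> sx; apply: (integral_cond_density mu mqm c0 qm2).
have mavg := @seq2_measurable_avg_density _ _ _ n s ms.
have [Q dQ] := @ex_density_kernel _ _ _ n mu (fun x => avg_density n s x) (mavg n)
  (fun x y => ltW (avg_density_gt0 n s0 x y))
  (fun x => integral_avg_density ms s0 s1 (size_tuple x)).
apply: le_trans (ereal_inf_lbound _) _; first by exists Q.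
apply: ge_ereal_sup => _ [P hmmP <-].
case: hmmP => d' [W [Pr [init [M [emis [Z [X [hmm emisQ PE]]]]]]]].
have M1 := hmm_trans_sum hmm; have M0 := hmm_trans_ge0 hmm.
have v0 := hmm_init_ge0 hmm; have v1 := hmm_init_sum hmm.
pose e i := projT1 (cid (ex_density (hmu _ (emisQ i)))).
have de i : is_density mu (emis i) (e i) := projT2 (cid (ex_density (hmu _ (emisQ i)))).
have me i : measurable_fun setT (e i) by case: (de i).
have e0 i y : 0 <= e i y by case: (de i).
have e1 i : (\int[mu]_y (e i y)%:E = 1)%E := integral_density1 (de i).
have e1m i m : tint mu m (fun x => (\prod_(y <- x) e i y)%:E) = 1%E by exact: tint_prod_density.
pose i0 : 'I_k := Ordinal k0.
have mp v := seq_measurable_plik M me v.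
have pv0 x : 0 <= plik M e init x by exact: plik_ge0.
have [K dK] := @ex_density_kernel _ _ _ n mu (fun x => hmm_cond M e init x)
  (@seq2_measurable_hmm_cond _ _ _ _ M _ me init n)
  (fun x y => hmm_cond_ge0 M0 e0 x y v0)
  (fun x => integral_hmm_cond M1 M0 me e0 e1 x v0).
apply: le_trans (cond_KL_le (K := K) (p := plik M e init) (mp init) pv0 (hmm_density M1 M0 de i0 hmm PE)
  (seq2_measurable_hmm_cond M me init) _ _ _ dK mavg (avg_density_gt0 n s0) dQ) _.
- by move=> x y; exact: hmm_cond_ge0.
- move=> x y; rewrite /hmm_cond; case: eqVneq => [px0|px0]; last by rewrite mulrCA divff ?mulr1.
  by rewrite px0 mul0r plik_rcons_eq0.
- by move=> x; exact: integral_plik.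
apply: tint_avg_density => //; first exact: (hmm_stationary hmm).
move=> a; have va i : 0 <= (delta_mx ord0 a : 'rV[R]_k) ord0 i.
  by rewrite mxE; case: (_ && _).
have va1 : \sum_i (delta_mx ord0 a : 'rV[R]_k) ord0 i = 1.
  rewrite (bigD1 a) //= mxE !eqxx big1 ?addr0 // => i ia.
  by rewrite mxE (negbTE ia) andbF.
have := @sum_pred_risk _ _ _ mu n.+1 qm _ mqm c0 qm2 qm1 (plik M e (delta_mx ord0 a))
  (mp _) (fun x => plik_ge0 M0 e0 x va).
rewrite /pred_risk -/s => -> //.
- apply: tint_gkl_mixture => //.
    rewrite addr_ge0 // mulr_ge0 // ?rho0 ?divr_ge0 // addr_ge0 // ln_ge0 // ler1n //.
  move=> z; have := tint_gkl_path me e0 e1m mq q0 q1 z; rewrite size_tuple => ->.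
  have zk : (size z)%:R / k%:R = n.+1%:R / k%:R :> R by rewrite size_tuple.
  rewrite -zk; apply: (@le_trans _ _ (\sum_(i < k) (rho (count_mem i z)%:R + (1 + ln 2)))%:E).
    by rewrite -sumEFin; apply: lee_sum => i _; rewrite addrA; exact: hq.
  by rewrite lee_fin jensen_path_cost.
- by move=> x; exact: integral_plik.
- by move=> x y; exact: plik_rcons_eq0.
Qed.
End risk.

Section numerics.
Context {R : realType}.

Lemma ln2_bounds : 2^-1 <= (ln 2 : R) <= 1.
Proof.
apply/andP; split; last first.
  by have := @le_ln1Dx R 1; rewrite (_ : 1 + 1 = 2) //; apply; lra.
have : ln (1 + - 2^-1) <= - 2^-1 :> R by apply: le_ln1Dx; lra.
rewrite (_ : 1 + - 2^-1 = 2^-1 :> R); last by lra.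
by rewrite lnV ?posrE // lerN2.
Qed.

(** The constant [4] ensures [1 <= ln (n / k ^ 2)], so that the terms of order
    [k ^ 2] and [k] are absorbed in [k ^ 2 * ln (n / k ^ 2)]. *)
Lemma rate_le (n k : nat) (rho : R) : (0 < k)%N -> 0 <= rho -> 4 * k%:R ^+ 2 <= n%:R :> R ->
  n.+1%:R^-1 * (ln k%:R + (k%:R ^+ 2 + k%:R ^+ 2 * ln (1 + n%:R / k%:R ^+ 2)) +
     (k%:R * rho + k%:R * (1 + ln 2))) <=
  6 * (k%:R ^+ 2 / n%:R * ln (n%:R / k%:R ^+ 2) + k%:R / n%:R * rho) :> R.
Proof.
move=> k0 rho0 kn; have kR : 1 <= k%:R :> R by rewrite ler1n.
set K : R := k%:R ^+ 2 in kn *.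
have kK : k%:R <= K by rewrite /K expr2 ler_peMl // (le_trans _ kR).
have K1 : 1 <= K by rewrite (le_trans kR).
have K0 : 0 < K by rewrite (lt_le_trans _ K1).
have n0 : 0 < n%:R :> R by rewrite (lt_le_trans _ kn) // mulr_gt0.
have /andP[l2 l2'] := ln2_bounds.
set x := n%:R / K; have x4 : 4 <= x by rewrite ler_pdivlMr.
have x0 : 0 < x by rewrite (lt_le_trans _ x4).
have L1 : 1 <= ln x.
  apply: (@le_trans _ _ (ln 4)); last by rewrite ler_ln ?posrE.
  have -> : ln 4 = ln 2 + ln 2 :> R by rewrite -lnM ?posrE // -natrM.
  lra.
have L2 : ln (1 + x) <= 2 * ln x.
  have x1 : 0 < 1 + x by lra.
  have x2 : 0 < 2 * x by lra.
  apply: (@le_trans _ _ (ln (2 * x))); first by rewrite ler_ln ?posrE //; lra.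
  by rewrite lnM ?posrE //; lra.
have lk : ln k%:R <= K.
  apply: le_trans kK; rewrite -[X in ln X](_ : 1 + (k%:R - 1) = _); last by lra.
  by apply: le_trans (@le_ln1Dx R _ _) _; lra.
apply: (@le_trans _ _ (n%:R^-1 * (6 * (K * ln x) + 6 * (k%:R * rho)))).
  apply: ler_pM; rewrite ?invr_ge0 //.
  - rewrite !addr_ge0 ?mulr_ge0 ?ln_ge0 //; lra.
  - by rewrite lef_pV2 ?posrE // ler_nat.
  - have h1 : K * ln (1 + x) <= K * (2 * ln x) by rewrite ler_wpM2l // ltW.
    have h2 : K <= K * ln x by rewrite ler_peMr // ltW.
    have h3 : k%:R * (1 + ln 2) <= 2 * K.
      by apply: (@le_trans _ _ (k%:R * 2)); [rewrite ler_wpM2l //; lra|lra].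
    have h4 : 0 <= k%:R * rho by rewrite mulr_ge0.
    lra.
rewrite le_eqVlt; apply/orP; left; apply/eqP.
by rewrite -/x; field; rewrite gt_eqF.
Qed.

End numerics.

Theorem corollary1 (R : realType) :
  exists c C : R, 0 < c /\ 0 < C /\
  forall (d : measure_display) (T : measurableType d)
    (Qs : set (probability T R)) (rho : R -> R) (n k : nat),
    (forall x, 0 <= x -> 0 <= rho x) ->
    concave_on_nonneg rho ->
    (forall t : nat, (Red (iid_class Qs t) <= (rho t%:R)%:E)%E) ->
    (0 < k)%N ->
    c * k%:R ^+ 2 <= n%:R ->
    (Risk (hmm_class n k Qs) <=
      (C * (k%:R ^+ 2 / n%:R * ln (n%:R / k%:R ^+ 2)
            + k%:R / n%:R * rho (n.+1%:R / k%:R)))%:E)%E.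
Proof.
exists 4, 6; split=> //; split=> // d T Qs rho n k rho0 crho hRed k0 kn.
have n0 : (0 < n)%N.
  by rewrite -(ltr0n R) (lt_le_trans _ kn) // mulr_gt0 // exprn_gt0 // ltr0n.
apply: le_trans (Risk_hmm_le n rho0 crho hRed k0) _; rewrite lee_fin.
apply: le_trans (rate_le k0 (rho0 _ _) kn); last by rewrite divr_ge0.
by rewrite ler_wpM2l ?invr_ge0 // lerD2r; exact: ln_card_markov_types.
Qed.
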